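(* Let $p>0$, $q_1>0$, $q_2>0$ be fixed with $p+q_1+q_2=1$, and let $X_1,X_2,\ldots$ be independent random variables with $P(X_i=0)=p$, $P(X_i=+1)=q_1$, $P(X_i=-1)=q_2$. Let $\mu(N)$ be the length of the longest at most $1+1$ contaminated run in $X_1,X_2,\ldots,X_N$. Let $m(N)$, the function $H=H_N$ and the constant $C_0$ be as defined in the context. Then for every (fixed) integer $k$, as $N\to\infty$, $$P\bigl(\mu(N)-[m(N)]<k\bigr)=\exp\left(-p^{-\left(\log(C_0p^{-2}q_1q_2)+H(k-\{m(N)\})\right)}\right)\left(1+O\left(\frac{1}{(\log N)^3}\right)\right),$$ where $\log$ denotes the logarithm to base $1/p$, and $[m(N)]$ and $\{m(N)\}=m(N)-[m(N)]$ denote the integer part and the fractional part of $m(N)$.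
   Context: A finite block of consecutive terms of the sequence is called an at most $1+1$ contaminated run if it contains at most one value $+1$ and at most one value $-1$ (all other values being $0$); its length is its number of terms. Throughout, $\log$ is the logarithm to base $1/p$, $\ln$ is the natural logarithm, and $C=\ln\frac1p$. Set $$C_0=q_1+q_2,\qquad C_1=\frac{p(q_1^2+q_2^2)}{q_1q_2}-1,\qquad C_2=\frac{(q_1^2+q_2^2)p^2}{q_1q_2(p-1)}+\frac{p}{p-1}+\frac{2(2p+1)q_1q_2}{(p-1)^3},$$ $$K=\frac{2C_0C_2-C_1^2-C_0^2}{2CC_0^2}.$$ For $N$ large enough that the iterated logarithms are defined, $$\begin{aligned} m(N)={}&\log N+2\log\log N+\frac{4\log\log N}{C\log N}+\frac{C_1-C_0}{CC_0}\frac{1}{\log N}\\ &-\frac4C\frac{(\log\log N)^2}{(\log N)^2}+\left(\frac{8}{C^2}-\frac{2(C_1-C_0)}{CC_0}\right)\frac{\log\log N}{(\log N)^2}+\left(\frac{2(C_1-C_0)}{C^2C_0}+K\right)\frac{1}{(\log N)^2}\\ &+\frac{16}{3C}\frac{(\log\log N)^3}{(\log N)^3}+\left(-\frac{16}{C^2}+\frac{4(C_1-C_0)}{CC_0}\right)\frac{(\log\log N)^2}{(\log N)^3}-\left(4K+\frac{8(C_1-C_0)}{C^2C_0}\right)\frac{\log\log N}{(\log N)^3}\\ &+\frac{16}{C^3}\frac{\log\log N}{(\log N)^3}-\frac{8}{C^2}\frac{(\log\log N)^2}{(\log N)^3}-\frac{4(C_1-C_0)}{C^2C_0}\frac{\log\log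 N}{(\log N)^3}, \end{aligned}$$ and the function $H$ (depending on $N$) is $$\begin{aligned} H(x)={}&-x+\frac{2}{C\log N}x-\frac4C\frac{\log\log N}{(\log N)^2}x-\frac{C_1-C_0}{CC_0}\frac{1}{(\log N)^2}x\\ &+\left(\frac{4(C_1-C_0)}{CC_0}-\frac{8}{C^2}\right)\frac{\log\log N}{(\log N)^3}x+\frac8C\frac{(\log\log N)^2}{(\log N)^3}x-\frac1C\frac{1}{(\log N)^2}x^2+\frac4C\frac{\log\log N}{(\log N)^3}x^2 . \end{aligned}$$ *)

(* Defs.v *)
From HB Require Import structures.
From mathcomp Require Export all_boot all_order all_algebra finmap.
From mathcomp Require Export all_classical all_reals all_analysis.

Export Order.TTheory GRing.Theory Num.Theory.
Export numFieldNormedType.Exports.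

Set Implicit Arguments.
Unset Strict Implicit.
Unset Printing Implicit Defensive.

Local Open Scope classical_set_scope.
Local Open Scope ring_scope.

Definition mutually_independent (d : measure_display) (T : measurableType d)
    (R : realType) (P : probability T R) (X : nat -> {RV P >-> R}) : Prop :=
  forall (J : {fset nat}) (B : nat -> set R),
    (forall j, j \in J -> measurable (B j)) ->
    P (\bigcap_(j in [set` J]) (X j @^-1` B j)) =
    (\prod_(j <- J) P (X j @^-1` B j))%E.

Section Runs.
Variable R : realType.
Implicit Type u : nat -> R.

(* The block u_i, ..., u_(i + l - 1). *)
Definition contaminated11 u (i l : nat) : bool :=
  let b := [seq u j | j <- iota i l] in
  [&& all (fun x => x \in [:: 0; 1; -1]) b,
      (count_mem 1%R b <= 1)%N & (count_mem (-1)%R b <= 1)%N].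

(* Sequences are indexed from 0, so the first N terms are u_0, ..., u_(N - 1). *)
Definition longest_run u (N : nat) : nat :=
  \max_(l < N.+1 |
     [exists i : 'I_N.+1, (i + l <= N)%N && contaminated11 u i l]) l.

End Runs.

Section Constants.
Variables (R : realType) (p q1 q2 : R).

Definition logp (x : R) : R := ln x / ln p^-1.

Definition C : R := ln p^-1.
Definition C0 : R := q1 + q2.
Definition C1 : R := p * (q1 ^+ 2 + q2 ^+ 2) / (q1 * q2) - 1.
Definition C2 : R :=
  (q1 ^+ 2 + q2 ^+ 2) * p ^+ 2 / (q1 * q2 * (p - 1)) + p / (p - 1)
  + 2 * (2 * p + 1) * q1 * q2 / (p - 1) ^+ 3.
Definition K : R :=
  (2 * C0 * C2 - C1 ^+ 2 - C0 ^+ 2) / (2 * C * C0 ^+ 2).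

(* Only large N matter: for small N the iterated logarithm takes junk values. *)
Definition m (N : nat) : R :=
  let L := logp N%:R in
  let l := logp L in
  L + 2 * l + 4 * l / (C * L) + (C1 - C0) / (C * C0) * (1 / L)
  - 4 / C * (l ^+ 2 / L ^+ 2)
  + (8 / C ^+ 2 - 2 * (C1 - C0) / (C * C0)) * (l / L ^+ 2)
  + (2 * (C1 - C0) / (C ^+ 2 * C0) + K) * (1 / L ^+ 2)
  + 16 / (3 * C) * (l ^+ 3 / L ^+ 3)
  + (- (16 / C ^+ 2) + 4 * (C1 - C0) / (C * C0)) * (l ^+ 2 / L ^+ 3)
  - (4 * K + 8 * (C1 - C0) / (C ^+ 2 * C0)) * (l / L ^+ 3)
  + 16 / C ^+ 3 * (l / L ^+ 3)
  - 8 / C ^+ 2 * (l ^+ 2 / L ^+ 3)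
  - 4 * (C1 - C0) / (C ^+ 2 * C0) * (l / L ^+ 3).

Definition H (N : nat) (x : R) : R :=
  let L := logp N%:R in
  let l := logp L in
  - x + 2 / (C * L) * x - 4 / C * (l / L ^+ 2) * x
  - (C1 - C0) / (C * C0) * (1 / L ^+ 2) * x
  + (4 * (C1 - C0) / (C * C0) - 8 / C ^+ 2) * (l / L ^+ 3) * x
  + 8 / C * (l ^+ 2 / L ^+ 3) * x
  - 1 / C * (1 / L ^+ 2) * x ^+ 2
  + 4 / C * (l / L ^+ 3) * x ^+ 2.

End Constants.

Definition frac (R : realType) (x : R) : R := x - (Num.floor x)%:~R.

(* Main.v *)
(* Write n = [m(N)] + k. The event is that none of the N - n + 1 windows of length
   n is contaminated at most 1+1. Declustering gives its probability as
   exp(-N lam) up to a small error, where lam is the probability that a window is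
   such a run and none of the next n windows is. Summing over the positions of
   the two nonzero letters gives the exact value
     lam = p^(n-2) q1 q2 (C0 n^2 + (C1 - C0) n + (C2 - C1) + O(n^2 p^n)),
   and m and H are precisely the expansion of log(N lam) at n = m + x, up to an
   error O(1/(log N)^3), which is harmless because N lam stays bounded. *)
Require Import Defs.
From mathcomp Require Import ring lra zify.

Set Implicit Arguments.
Unset Strict Implicit.
Unset Printing Implicit Defensive.

Local Open Scope classical_set_scope.
Local Open Scope ring_scope.

(** * Words and the chance of avoiding runs *)

(** Probabilities are finite weighted sums over words in three letters; measure theory enters only
    at the end, to identify the event with avoidance of runs by a random word. With n near log N the
    chance of a run at a given place is O(1/N), so declustering costs an absolute error O(log N /
    N). It becomes a relative error because the rate is bounded, hence exp(-rate) is bounded below.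
    The delicate point is that n reappears inside log n. With L = log N, m is an approximate fixed
    point, m = L + 2 log m + a/m + K/m^2 + O(L^-3) where a = (C1 - C0)/(C C0), and H records how L -
    n + 2 log n + a/n + K/n^2 varies with x = n - m. Substituting n back produces mixed powers of
    1/L and (log L)/L. Both count as degree one: every monomial of degree at most three must cancel
    exactly, except L^-3 itself, and degree four is negligible because (log L)^4 = O(L). *)

Local Notation letter := (option bool).
Local Notation plus := (Some true).
Local Notation minus := (Some false).

Definition admissible (s : seq letter) : bool :=
  (count_mem plus s <= 1)%N && (count_mem minus s <= 1)%N.

Definition run_at (n : nat) (s : seq letter) : bool :=
  (n <= size s)%N && admissible (take n s).

(** The empty suffix, which would be a run only for [n = 0], is not tested; the main estimates take
    [n] positive. *)
Fixpoint avoids (n : nat) (s : seq letter) : bool :=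
  if s is _ :: s' then ~~ run_at n s && avoids n s' else true.

Lemma avoids_drop n j s : avoids n s -> avoids n (drop j s).
Proof. by elim: s j => [|x s IH] [|j] //= /andP[_ /IH]; apply. Qed.

Lemma avoids_catl n s t : avoids n (s ++ t) -> avoids n s.
Proof.
elim: s => //= x s IH /andP[nr /IH ->]; rewrite andbT.
apply: contra nr; rewrite /run_at /= size_cat => /andP[les].
rewrite (leq_trans les) ?leq_addr ?ltnS ?leq_addr //=.
by rewrite -cat_cons takel_cat.
Qed.

Lemma avoidsP n s :
  reflect (forall j, (j < size s)%N -> ~~ run_at n (drop j s)) (avoids n s).
Proof.
apply: (iffP idP) => [+ j|].
  elim: s j => [|x s IH] [|j] //= /andP[//] nr /IH; exact.
elim: s => //= x s IH H; rewrite (H 0%N) //=.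
by apply: IH => j lt; apply: (H j.+1).
Qed.

Section Words.
Variables (R : realType) (p q1 q2 : R).

(** Total probability by the first letter. Independence of disjoint blocks then reads [expect_cat],
    and stationarity reads [expect_drop]. *)
Fixpoint expect (n : nat) (phi : seq letter -> R) : R :=
  if n is n'.+1 then
    p * expect n' (fun s => phi (None :: s))
    + q1 * expect n' (fun s => phi (plus :: s))
    + q2 * expect n' (fun s => phi (minus :: s))
  else phi [::].

Lemma eq_expect n f g :
  (forall s, size s = n -> f s = g s) -> expect n f = expect n g.
Proof.
elim: n f g => [|n IH] f g fg /=; first exact: fg.
by congr (_ * _ + _ * _ + _ * _); apply: IH => s sz; apply: fg; rewrite /= sz.
Qed.

Lemma expect_eq0 n f : (forall s, f s = 0) -> expect n f = 0.
Proof.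
by elim: n f => [|n IH] f f0 /=; rewrite ?f0 // !IH ?mulr0 ?addr0.
Qed.

Lemma expectD n f g :
  expect n (fun s => f s + g s) = expect n f + expect n g.
Proof. by elim: n f g => //= n IH f g; rewrite !IH; ring. Qed.

Lemma expectZ n c f : expect n (fun s => c * f s) = c * expect n f.
Proof. by elim: n f => //= n IH f; rewrite !IH; ring. Qed.

Lemma expectZr n c f : expect n (fun s => f s * c) = expect n f * c.
Proof. by elim: n f => //= n IH f; rewrite !IH; ring. Qed.

Lemma expectB n f g :
  expect n (fun s => f s - g s) = expect n f - expect n g.
Proof. by elim: n f g => //= n IH f g; rewrite !IH; ring. Qed.

Lemma expect_sum n k (f : nat -> seq letter -> R) :
  expect n (fun s => \sum_(i < k) f i s) = \sum_(i < k) expect n (f i).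
Proof.
elim: k => [|k IH].
  rewrite big_ord0 -[RHS](mul0r (expect n (fun=> 0))) -expectZ.
  by apply: eq_expect => s _; rewrite big_ord0 mul0r.
rewrite big_ord_recr /= -IH -expectD.
by apply: eq_expect => s _; rewrite big_ord_recr.
Qed.

Lemma expect_cat a b f :
  expect (a + b) f = expect a (fun u => expect b (fun v => f (u ++ v))).
Proof. by elim: a f => //= a IH f; rewrite !IH. Qed.

Lemma expect_rcons n f :
  expect n.+1 f = p * expect n (fun s => f (rcons s None))
    + q1 * expect n (fun s => f (rcons s plus))
    + q2 * expect n (fun s => f (rcons s minus)).
Proof.
elim: n f => // n IH f.
rewrite -[LHS]/(p * expect n.+1 _ + q1 * expect n.+1 _ + q2 * expect n.+1 _).
by rewrite (IH (fun s => f (None :: s))) (IH (fun s => f (plus :: s)))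
  (IH (fun s => f (minus :: s))) /=; ring.
Qed.

Hypotheses (p_ge0 : 0 <= p) (q1_ge0 : 0 <= q1) (q2_ge0 : 0 <= q2).

Lemma le_expect n f g :
  (forall s, size s = n -> f s <= g s) -> expect n f <= expect n g.
Proof.
elim: n f g => [|n IH] f g fg /=; first exact: fg.
by rewrite !lerD // ler_wpM2l //; apply: IH => s sz; apply: fg; rewrite /= sz.
Qed.

Lemma expect_ge0 n f : (forall s, size s = n -> 0 <= f s) -> 0 <= expect n f.
Proof.
move=> f0; rewrite -[leLHS](mul0r (expect n (fun=> 0))) -expectZ.
by apply: le_expect => s sz; rewrite mul0r f0.
Qed.

Hypothesis pq1 : p + q1 + q2 = 1.

Lemma expect_cst n c : expect n (fun=> c) = c.
Proof. by elim: n => //= n ->; rewrite -!mulrDl pq1 mul1r. Qed.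

Lemma expect_drop j n f :
  expect (j + n) (fun s => f (drop j s)) = expect n f.
Proof.
rewrite expect_cat -[RHS](expect_cst j); apply: eq_expect => u szu.
by apply: eq_expect => v _; rewrite drop_size_cat.
Qed.

Definition avoid_prob n N : R := expect N (fun s => (avoids n s)%:R).
Definition run_prob n : R := expect n (fun s => (admissible s)%:R).
(* A run starts at the first letter and none at the next [n] positions: since
   runs cluster, this, and not [run_prob], is the rate at which avoidance fails. *)
Definition last_run_prob n : R :=
  expect (n + n) (fun s => (run_at n s && avoids n (behead s))%:R).

Lemma run_prob_ge0 n : 0 <= run_prob n.
Proof. by apply: expect_ge0. Qed.

Lemma expect_run_at n N : expect N (fun s => (run_at n s)%:R) <= run_prob n.
Proof.
have [le_nN|lt_Nn] := leqP n N; last first.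
  rewrite (@eq_expect _ _ (fun=> 0)) ?expect_cst ?run_prob_ge0 // => s sz.
  by rewrite /run_at sz leqNgt lt_Nn.
rewrite -(subnKC le_nN) expect_cat; apply: le_expect => u szu.
rewrite -[leRHS](expect_cst (N - n)); apply: le_expect => v _.
rewrite ler_nat /run_at take_size_cat //.
by rewrite size_cat szu leq_addr.
Qed.

Lemma expect_run_at_drop n j N :
  expect N (fun s => (run_at n (drop j s))%:R) <= run_prob n.
Proof.
have [le_jN|lt_Nj] := leqP j N.
  rewrite -(subnKC le_jN) (expect_drop j (N - j) (fun s => (run_at n s)%:R)).
  exact: expect_run_at.
rewrite (@eq_expect _ _ (fun=> (run_at n [::])%:R)); last first.
  by move=> s sz; rewrite drop_oversize // sz ltnW.
by rewrite expect_cst; case: n => [|n] //; exact: (run_prob_ge0 n.+1).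
Qed.

(** Deleting the first letter of a word of length N + 1 leaves the law of a word of length N, so
    both avoidance probabilities can be compared on the same words. *)
Lemma avoid_prob_step n N :
  avoid_prob n N - avoid_prob n N.+1 =
  expect N.+1 (fun s => (run_at n s && avoids n (behead s))%:R).
Proof.
rewrite /avoid_prob -(@expect_drop 1 N) -expectB; apply: eq_expect.
by case=> // x s _; rewrite /= drop0; case: run_at; case: avoids; rewrite /= ?subr0 ?subrr.
Qed.

Lemma avoid_prob_step_ge0 n N : 0 <= avoid_prob n N - avoid_prob n N.+1.
Proof. by rewrite avoid_prob_step; apply: expect_ge0. Qed.

Lemma avoid_prob_step_le n N :
  avoid_prob n N - avoid_prob n N.+1 <= run_prob n.
Proof.
rewrite avoid_prob_step; apply: le_trans (expect_run_at n N.+1).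
by apply: le_expect => s _; rewrite ler_nat; case: run_at => //; rewrite leq_b1.
Qed.

Lemma last_run_prob_ge0 n : 0 <= last_run_prob n.
Proof. exact: expect_ge0. Qed.

Lemma last_run_prob_le n : last_run_prob n <= run_prob n.
Proof.
apply: le_trans (expect_run_at n (n + n)).
by apply: le_expect => s _; rewrite ler_nat; case: run_at => //; rewrite leq_b1.
Qed.

Lemma run_at_cat n u v : (n <= size u)%N -> run_at n (u ++ v) = run_at n u.
Proof. by move=> nu; rewrite /run_at size_cat takel_cat // (leq_trans nu) ?leq_addr // nu. Qed.

(** Only the constraints inside the first 2n letters and inside the last [b] letters are kept; these
    two blocks are independent. *)
Lemma avoid_prob_step_upper n b : (0 < n)%N ->
  avoid_prob n (n + n + b).-1 - avoid_prob n (n + n + b) <=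
  last_run_prob n * avoid_prob n b.
Proof.
move=> n0; have -> : avoid_prob n (n + n + b) = avoid_prob n (n + n + b).-1.+1.
  by rewrite prednK // !addn_gt0 n0.
rewrite avoid_prob_step prednK ?addn_gt0 ?n0 // expect_cat.
rewrite -expectZr; apply: le_expect => u szu.
rewrite -expectZ; apply: le_expect => v _.
rewrite run_at_cat ?szu ?leq_addr // -natrM ler_nat mulnb.
case: run_at => //=; case: u szu => [/= szu|x u szu /=]; first by lia.
case: (boolP (avoids n (u ++ v))) => // av.
by rewrite (avoids_catl av); move: (avoids_drop (size u) av); rewrite drop_size_cat // => ->.
Qed.

(** The constraints on the two blocks miss only the windows straddling position 2n. These start
    after offset n, so they are disjoint from the first window and each costs at most the square of
    [run_prob]. *)
Lemma avoid_prob_step_lower n b : (0 < n)%N ->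
  last_run_prob n * avoid_prob n b - n%:R * run_prob n ^+ 2 <=
  avoid_prob n (n + n + b).-1 - avoid_prob n (n + n + b).
Proof.
move=> n0; have -> : avoid_prob n (n + n + b) = avoid_prob n (n + n + b).-1.+1.
  by rewrite prednK // !addn_gt0 n0.
rewrite avoid_prob_step prednK ?addn_gt0 ?n0 // lerBlDr.
pose f (s : seq letter) : R := (run_at n s && avoids n (behead s))%:R.
have -> : last_run_prob n * avoid_prob n b =
    expect (n + n + b) (fun s => f (take (n + n) s) * (avoids n (drop (n + n) s))%:R).
  rewrite expect_cat -expectZr; apply: eq_expect => u szu.
  rewrite -expectZ; apply: eq_expect => v _.
  by rewrite take_size_cat // drop_size_cat.
(* Counts the runs starting at offsets n, ..., 2n - 1, given a run at the start; it dominates the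
   failure caused by straddling windows. *)
pose g (s : seq letter) : R := (run_at n s)%:R * \sum_(j < n) (run_at n (drop (n + j) s))%:R.
have gle : expect (n + n + b) g <= n%:R * run_prob n ^+ 2.
  have -> : n%:R * run_prob n ^+ 2 = run_prob n * \sum_(j < n) run_prob n.
    by rewrite sumr_const card_ord -mulr_natl; ring.
  have -> : expect (n + n + b) g = run_prob n *
      \sum_(j < n) expect (n + b) (fun s => (run_at n (drop j s))%:R).
    rewrite -(expect_sum _ _ (fun j s => (run_at n (drop j s))%:R)).
    rewrite -addnA expect_cat -expectZr; apply: eq_expect => u szu.
    rewrite -expectZ; apply: eq_expect => v _; rewrite /g.
    rewrite run_at_cat ?szu // /run_at szu leqnn take_oversize ?szu //=.
    by congr (_ * _); apply: eq_bigr => j _; rewrite addnC -drop_drop drop_size_cat.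
  rewrite ler_wpM2l ?run_prob_ge0 // ler_sum // => j _; exact: expect_run_at_drop.
apply: le_trans (lerD (lexx _) gle).
rewrite -expectD; apply: le_expect => s szs; rewrite /f /g.
have -> : run_at n (take (n + n) s) = run_at n s.
  by rewrite -[in RHS](cat_take_drop (n + n) s) run_at_cat // size_takel; lia.
case: (boolP (run_at n s)) => //= [ra|_]; last by rewrite !mul0r addr0.
rewrite mul1r -natrM -natr_sum -natrD ler_nat mulnb.
case: (boolP (avoids n (behead s))) => [_|nav].
  by rewrite (leq_trans (leq_b1 _)).
rewrite add0n; case: andP => // -[av1 av2].
rewrite lt0n; apply: contra nav; rewrite sum_nat_eq0 => /forallP H.
apply/avoidsP => j; rewrite size_behead szs => ltj.
rewrite -drop1 drop_drop addn1.
have [le_jn|lt_nj] := leqP j.+1 n; last first.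
  have [le_j2n|lt_2nj] := ltnP j.+1 (n + n).
    have lt : (j.+1 - n < n)%N by lia.
    by move: (H (Ordinal lt)) => /=; rewrite subnKC ?(ltnW lt_nj) //; case: run_at.
  have lt : (j.+1 - (n + n) < size (drop (n + n) s))%N by rewrite size_drop; lia.
  by move/avoidsP: av2 => /(_ _ lt); rewrite drop_drop subnK.
have lt : (j < size (behead (take (n + n) s)))%N by rewrite size_behead size_takel; lia.
move/avoidsP: av1 => /(_ _ lt); rewrite -drop1 drop_drop addn1.
rewrite -[in run_at n (drop _ s)](cat_take_drop (n + n) s) drop_cat size_takel; last by lia.
rewrite ifT ?run_at_cat //; last by lia.
by rewrite size_drop size_takel; lia.
Qed.

End Words.

(** * Exponential decay of the avoidance probability *)

Section Approximation.
Variables (R : realType) (p q1 q2 : R).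
Hypotheses (p_ge0 : 0 <= p) (q1_ge0 : 0 <= q1) (q2_ge0 : 0 <= q2).
Hypothesis pq1 : p + q1 + q2 = 1.

Let Q := avoid_prob p q1 q2.
Let P := run_prob p q1 q2.
Let lam := last_run_prob p q1 q2.

Lemma run_prob_le1 n : P n <= 1.
Proof.
rewrite -[leRHS](expect_cst pq1 n); apply: le_expect => // s _.
by rewrite lern1 leq_b1.
Qed.

Lemma avoid_prob_add n N j :
  Q n N - j%:R * P n <= Q n (N + j) /\ Q n (N + j) <= Q n N.
Proof.
elim: j => [|j [IH1 IH2]]; first by rewrite addn0 mul0r subr0.
have h1 := avoid_prob_step_ge0 p_ge0 q1_ge0 q2_ge0 pq1 n (N + j).
have h2 := avoid_prob_step_le p_ge0 q1_ge0 q2_ge0 pq1 n (N + j).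
rewrite addnS -natr1 mulrDl mul1r; split; rewrite /Q /P in IH1 IH2 *; lra.
Qed.

Lemma expRN_bounds (x : R) : 0 <= x -> 1 - x <= expR (- x) <= 1 - x + x ^+ 2.
Proof.
move=> x0; rewrite expR_ge1Dx /= expRN.
have x1 : 0 < 1 + x by lra.
apply: (@le_trans _ _ (1 + x)^-1); first by rewrite lef_pV2 ?posrE ?expR_gt0 // expR_ge1Dx.
rewrite -[leLHS]mul1r ler_pdivrMr //.
(* (1 + x)(1 - x + x^2) = 1 + x^3. *)
have : 0 <= x ^+ 3 by rewrite exprn_ge0.
by lra.
Qed.

(* By stationarity Q(N) - Q(N+1) is the probability that a run starts at the
   first letter and nowhere later. Events n letters apart being independent,
   it equals lam * Q(N) up to O(n P^2), hence the exponential decay. *)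
Lemma avoid_prob_approx n N : (0 < n)%N ->
  `|Q n N - expR (- (lam n * N%:R))| <=
  2 * n%:R * P n + 3 * n%:R * N%:R * P n ^+ 2.
Proof.
move=> n0.
have P0 : 0 <= P n by exact: run_prob_ge0.
have lam0 : 0 <= lam n by exact: last_run_prob_ge0.
have lamP : lam n <= P n by exact: last_run_prob_le.
have P1 := run_prob_le1 n.
have n1 : 1 <= n%:R :> R by rewrite ler1n.
(* Up to length 2n no decay has to be followed: both quantities lie between 1 - 2nP and 1. *)
have small M : (M <= n + n)%N ->
    `|Q n M - expR (- (lam n * M%:R))| <= 2 * n%:R * P n.
  move=> leM.
  have MR : M%:R <= n%:R + n%:R :> R by rewrite -natrD ler_nat.
  have M0 : 0 <= M%:R :> R by [].
  have [h1 h2] := avoid_prob_add n 0 M; rewrite add0n in h1 h2.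
  have Q0 : Q n 0 = 1 by [].
  have lM : 0 <= lam n * M%:R by rewrite mulr_ge0.
  have := expR_ge1Dx (- (lam n * M%:R)).
  have : expR (- (lam n * M%:R)) <= 1 by rewrite -[leRHS]expR0 ler_expR oppr_le0.
  have : lam n * M%:R <= P n * M%:R by rewrite ler_wpM2r.
  have : M%:R * P n <= (n%:R + n%:R) * P n by rewrite ler_wpM2r.
  move=> *; rewrite ler_norml; apply/andP; split; lra.
elim: N => [|N IH].
  by apply: le_trans (small 0%N _) _ => //; rewrite lerDl mulr0 mul0r.
have [le|lt] := leqP N.+1 (n + n).
  by apply: le_trans (small _ le) _; rewrite lerDl !mulr_ge0 ?exprn_ge0.
(* [b] is the length left beyond the first 2n letters. As N - b = 2n - 1, trading Q(b) for Q(N)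
   costs at most 2nP. *)
have eN : N.+1 = (n + n + (N.+1 - (n + n)))%N by rewrite subnKC // ltnW.
set b := (N.+1 - (n + n))%N in eN.
have up := avoid_prob_step_upper p_ge0 q1_ge0 q2_ge0 pq1 b n0.
have lo := avoid_prob_step_lower p_ge0 q1_ge0 q2_ge0 pq1 b n0.
rewrite -eN /= -/Q -/lam -/P in up lo.
have [b1 b2] := avoid_prob_add n b (n + n).-1.
have eb : (b + (n + n).-1)%N = N by rewrite /b; clear -lt n0; lia.
rewrite eb in b1 b2.
have nn : (n + n).-1%:R <= n%:R + n%:R :> R by rewrite -natrD ler_nat leq_pred.
have b3 : (n + n).-1%:R * P n <= (n%:R + n%:R) * P n by rewrite ler_wpM2r.
have u1 : lam n * Q n b <= lam n * (Q n N + (n%:R + n%:R) * P n).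
  by rewrite ler_wpM2l //; lra.
have u2 : lam n * Q n N <= lam n * Q n b by rewrite ler_wpM2l.
have u3 : lam n * ((n%:R + n%:R) * P n) <= P n * ((n%:R + n%:R) * P n).
  by rewrite ler_wpM2r // mulr_ge0 // addr_ge0.
have [e1 e2] := andP (expRN_bounds lam0).
set x := expR (- (lam n * N%:R)) in IH.
have x0 : 0 <= x by exact: expR_ge0.
have x1 : x <= 1.
  by rewrite -[leRHS]expR0 ler_expR oppr_le0 mulr_ge0.
have ex : expR (- (lam n * N.+1%:R)) = x * expR (- lam n).
  by rewrite -expRD; congr expR; rewrite -natr1; ring.
rewrite ex.
have v1 : x * (1 - lam n) <= x * expR (- lam n) by rewrite ler_wpM2l.
have v2 : x * expR (- lam n) <= x * (1 - lam n + lam n ^+ 2) by rewrite ler_wpM2l.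
have v3 : x * lam n ^+ 2 <= lam n ^+ 2 by rewrite ler_piMl ?exprn_ge0.
have v4 : lam n ^+ 2 <= P n ^+ 2 by rewrite lerXn2r ?nnegrE.
have v5 : P n ^+ 2 <= n%:R * P n ^+ 2 by rewrite ler_peMl ?exprn_ge0.
have D1 : `|(1 - lam n) * (Q n N - x)| <= `|Q n N - x|.
  by rewrite normrM ler_piMl // ger0_norm; lra.
(* The error contracts by 1 - lam and grows by at most 3nP^2: in the lower bound, 2nP^2 comes from
   trading Q(b) for Q(N) and nP^2 from replacing exp(-lam) by 1 - lam. *)
apply: le_trans (_ : `|(1 - lam n) * (Q n N - x)| + 3 * n%:R * P n ^+ 2 <= _); last first.
  by rewrite -natr1; lra.
set z := (1 - _) * _ in D1 *.
have : Q n N.+1 - x * expR (- lam n) - z <= 3 * n%:R * P n ^+ 2.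
  by rewrite /z; lra.
have : - (3 * n%:R * P n ^+ 2) <= Q n N.+1 - x * expR (- lam n) - z.
  by rewrite /z; lra.
have := ler_norm z; have := lerNnormlW (lexx `|z|).
by move=> *; rewrite ler_norml; apply/andP; split; lra.
Qed.

End Approximation.

(** * The rate of clumps of runs *)

(* One plus the index of [x] in [s], or 0 if [x] does not occur. *)
Definition mark (x : letter) (s : seq letter) : nat :=
  if x \in s then (index x s).+1 else 0%N.

Lemma mark_le_size x s : (mark x s <= size s)%N.
Proof. by rewrite /mark; case: ifP => //; rewrite index_mem. Qed.

Lemma mark_rcons x s y :
  mark x (rcons s y) =
  if x \in s then mark x s else if y == x then (size s).+1 else 0%N.
Proof.
rewrite /mark mem_rcons inE -cats1 index_cat /= (eq_sym y).
by case: (x \in s); case: (x == y); rewrite ?addn0.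
Qed.

(** A letter occurring at most once survives the drop exactly when its index is at least [j]; mark 0
    makes the formula cover an absent letter too. *)
Lemma count_mem_drop x j s :
  (count_mem x s <= 1)%N -> count_mem x (drop j s) = (j < mark x s)%N.
Proof.
elim: s j => [|y s IH] j //; rewrite /mark in_cons /= (eq_sym x).
case yx: (y == x); last move=> /= cs.
  rewrite add1n ltnS leqn0 => /eqP c0.
  case: j => [|j] /=; first by rewrite yx c0.
  by apply/eqP; rewrite -leqn0 -c0 -[X in (_ <= count _ X)%N](cat_take_drop j)
    count_cat leq_addl.
case: j => [|j] /=; last by rewrite IH // /mark; case: (x \in s).
by have := IH 0%N cs; rewrite yx drop0 /mark; case: (x \in s).
Qed.

(** The window at offset [j] holds the letters of [u] from [j] on and the first [j] letters of [v].
    An old letter has left once its mark is at most [j]; this boolean, read as 0 or 1, is the quota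
    of that sign remaining for [v]. *)
Lemma run_at_drop_cat n j u v : admissible u -> size u = n -> size v = n ->
  (j <= n)%N ->
  run_at n (drop j (u ++ v)) =
  (count_mem plus (take j v) <= (mark plus u <= j)%N)%N &&
  (count_mem minus (take j v) <= (mark minus u <= j)%N)%N.
Proof.
move=> /andP[a1 a2] su sv jn.
rewrite /run_at size_drop size_cat su sv drop_cat su.
have -> : (n <= n + n - j)%N by lia.
have -> : take n (if (j < n)%N then drop j u ++ v else drop (j - n) v) = drop j u ++ take j v.
  case: ltnP => h; first by rewrite take_cat size_drop su ifF ?subKn //; lia.
  have -> : j = n by lia.
  by rewrite subnn drop0 -su drop_size take_oversize ?sv ?take_oversize ?sv ?su.
rewrite /admissible !count_cat !count_mem_drop //=.
by congr (_ && _); rewrite ltnNge; case: (_ <= j)%N; rewrite ?add0n ?add1n.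
Qed.

(* Suppose that the letter after a run is [+1] and breaks it, and let [s] follow.
   Another run occurs exactly when the old [+1], of index [a], leaves the window
   before the next nonzero letter, or when both old nonzero letters, the later
   of index [c], have left it and [s] has brought at most one [-1] so far. *)
Definition reappears (a c : nat) (s : seq letter) : bool :=
  (count_mem plus (take a s) == 0) && (count_mem minus (take a s) == 0) ||
  (count_mem plus (take c s) == 0) && (count_mem minus (take c s) <= 1)%N.

Lemma count_take_le (x : letter) i j s : (i <= j)%N ->
  (count_mem x (take i s) <= count_mem x (take j s))%N.
Proof.
move=> ij; rewrite -(take_takel s ij).
by rewrite -[X in (_ <= count _ X)%N](cat_take_drop i) count_cat leq_addr.
Qed.

(** Sliding a run by one over a 0 gives a run again, so the letter after the last run of a clump is
    nonzero. *)
Lemma avoids_after_zero n u v : admissible u -> size u = n ->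
  size (None :: v) = n -> avoids n (behead (u ++ None :: v)) = false.
Proof.
move=> au su sv; have n0 : (0 < n)%N by rewrite -sv.
apply/negP => /avoidsP/(_ 0%N); rewrite size_behead size_cat su sv.
rewrite drop0 -drop1 run_at_drop_cat //= take0 /= => H.
by suff: false by []; apply: H; lia.
Qed.

(** Every later window of length n that starts inside [u] or at the breaking +1 contains this +1, so
    the old +1 must have left it. Sliding further only adds letters of [v], except that the quota of
    -1 rises from zero to one when the old -1 leaves. Hence the earliest offset in each of the two
    regimes decides, and these are the two arguments of [reappears]. *)
Lemma avoids_after_plus n u v : admissible u -> size u = n ->
  size (plus :: v) = n ->
  avoids n (behead (u ++ plus :: v)) =
  ~~ reappears (mark plus u).-1 (maxn (mark plus u) (mark minus u)).-1 v.
Proof.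
move=> au su sv.
set a := mark plus u; set b := mark minus u.
have an : (a <= n)%N by rewrite -su mark_le_size.
have bn : (b <= n)%N by rewrite -su mark_le_size.
have n0 : (0 < n)%N by rewrite -sv.
have E j : (j < n)%N -> run_at n (drop j (behead (u ++ plus :: v))) =
   [&& (a <= j.+1)%N, count_mem plus (take j v) == 0%N &
      (count_mem minus (take j v) <= (b <= j.+1)%N)%N].
  move=> jn; rewrite -drop1 drop_drop addn1 run_at_drop_cat //= -/a -/b.
  by rewrite add0n add1n; case: (a <= _)%N; rewrite //= ltnS leqn0.
apply/avoidsP/negP => [H|H j].
  move=> /orP[/andP[c1 c2]|/andP[c1 c2]].
    have lt : (a.-1 < n)%N by lia.
    have /negP := H a.-1 ltac:(rewrite size_behead size_cat su sv; lia).
    by apply; rewrite E // c1 (eqP c2) leq0n andbT; lia.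
  have lt : ((maxn a b).-1 < n)%N by lia.
  have /negP := H (maxn a b).-1 ltac:(rewrite size_behead size_cat su sv; lia).
  apply; rewrite E // c1 /=; apply/andP; split; first by lia.
  by have -> : (b <= (maxn a b).-1.+1)%N by lia.
rewrite size_behead size_cat su sv => lt.
have [jn|nj] := ltnP j n; last first.
  by rewrite /run_at size_drop size_behead size_cat su sv; apply/negP => /andP[]; lia.
rewrite E //; apply/negP => /and3P[aj c1 c2]; apply: H; rewrite /reappears.
move: c2; case: (leqP b j.+1) => bj /=.
  move=> c2; apply/orP; right.
  have le : ((maxn a b).-1 <= j)%N by lia.
  have := count_take_le plus v le; rewrite (eqP c1) leqn0 => -> /=.
  exact: leq_trans (count_take_le minus v le) c2.
rewrite leqn0 => c2; apply/orP; left.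
have le : (a.-1 <= j)%N by lia.
have := count_take_le plus v le; rewrite (eqP c1) leqn0 => -> /=.
by have := count_take_le minus v le; rewrite (eqP c2) leqn0.
Qed.

(** With [expect_flip], this sign change reduces a -1 after the run to a +1, at the price of
    exchanging [q1] and [q2]. *)
Definition flip : seq letter -> seq letter := map (omap negb).

Lemma count_flip b s : count_mem (Some b) (flip s) = count_mem (Some (~~ b)) s.
Proof. by elim: s => //= -[[]|] s ->; case: b. Qed.

Lemma admissible_flip s : admissible (flip s) = admissible s.
Proof. by rewrite /admissible !count_flip andbC. Qed.

Lemma avoids_flip n s : avoids n (flip s) = avoids n s.
Proof.
elim: s => //= x s ->; congr (~~ _ && _).
by rewrite /run_at -map_cons -map_take size_map [admissible _]admissible_flip.
Qed.

Lemma expect_flip (R : realType) (p q1 q2 : R) n f :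
  expect p q1 q2 n (fun s => f (flip s)) = expect p q2 q1 n f.
Proof.
elim: n f => //= n IH f.
by rewrite -!(IH (fun s => f (_ :: s))) /=; ring.
Qed.

Section Positions.
Variables (R : realType) (p q1 q2 : R).
Hypothesis p_neq0 : p != 0.

(** Either the first [a] letters are all 0, or exactly one -1 sits among the first [a] and the other
    c - 1 of the first [c] letters are 0. [p ^+ c / p] stands for p^(c-1); for [c = 0] the factor
    [a] is 0. *)
Lemma expect_reappears n a c : p + q1 + q2 = 1 -> (a <= c <= n)%N ->
  expect p q1 q2 n (fun s => (reappears a c s)%:R) =
  p ^+ a + a%:R * (p ^+ c / p) * q2.
Proof.
move=> pq1; elim: n a c => [|n IH] a c /andP[ac cn].
  have -> : c = 0%N by lia. have -> : a = 0%N by lia.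
  by rewrite /= !mul0r addr0 expr0.
case: a ac => [|a] ac.
  rewrite (@eq_expect _ _ _ _ _ _ (fun=> 1)) ?expect_cst ?expr0 ?mul0r ?addr0 //.
  by move=> s _; rewrite /reappears take0.
case: c ac cn => // c ac cn.
have zeros k : (k <= n)%N -> expect p q1 q2 n (fun s =>
    ((count_mem plus (take k s) == 0%N) && (count_mem minus (take k s) == 0%N))%:R) = p ^+ k.
  elim: n k {IH cn} => [|n' IH'] [|k] kn //.
    rewrite (@eq_expect _ _ _ _ _ _ (fun=> 1)) ?expect_cst ?expr0 //.
    by move=> s _; rewrite take0.
  rewrite /= IH' // !expect_eq0 => [|s|s]; rewrite ?add1n ?andbF //.
  by rewrite !mulr0 !addr0 exprS.
have e1 : expect p q1 q2 n (fun s => (reappears a.+1 c.+1 (plus :: s))%:R) = 0.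
  exact: expect_eq0.
have e2 : expect p q1 q2 n (fun s => (reappears a.+1 c.+1 (minus :: s))%:R) = p ^+ c.
  rewrite -(zeros c) //; apply: eq_expect => s _.
  by rewrite /reappears /= !add1n !add0n ltnS leqn0 andbF.
have e3 : expect p q1 q2 n (fun s => (reappears a.+1 c.+1 (None :: s))%:R) =
    p ^+ a + a%:R * (p ^+ c / p) * q2 by apply: IH; apply/andP.
rewrite [LHS]/= e1 e2 e3 !exprS -natr1; field.
by [].
Qed.

End Positions.

Lemma count_mem_rcons (x y : letter) s :
  count_mem x (rcons s y) = (count_mem x s + (y == x))%N.
Proof. by rewrite -cats1 count_cat /= addn0. Qed.

Lemma mark_rcons_neq x s y : y != x -> mark x (rcons s y) = mark x s.
Proof. by rewrite mark_rcons => /negPf ->; rewrite /mark; case: (x \in s). Qed.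

Lemma mark_rcons_new x s :
  count_mem x s == 0%N -> mark x (rcons s x) = (size s).+1.
Proof.
by rewrite mark_rcons eqxx -leqn0 leqNgt -has_count has_pred1 => /negPf ->.
Qed.

(** * Sums over admissible words by the positions of their nonzero letters *)

Section Classes.
Variables (R : realType) (p q1 q2 : R).
Hypothesis p_neq0 : p != 0.

(** Its evaluations proceed by induction on the last letter: appending keeps all earlier marks, and
    a new nonzero letter receives mark n + 1. *)
Definition class_sum i j n (phi : nat -> nat -> R) : R :=
  expect p q1 q2 n (fun s =>
    ((count_mem plus s == i) && (count_mem minus s == j))%:R
     * phi (mark plus s) (mark minus s)).

Lemma class_sum00 n phi : class_sum 0 0 n phi = p ^+ n * phi 0%N 0%N.
Proof.
rewrite /class_sum; elim: n => [|n IH]; first by rewrite /= mul1r.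
rewrite expect_rcons [X in _ + q1 * X + _]expect_eq0 => [|s]; last first.
  by rewrite !count_mem_rcons addn1 mul0r.
rewrite [X in _ + q2 * X]expect_eq0 => [|s]; last first.
  by rewrite !count_mem_rcons addn1 andbF mul0r.
rewrite !mulr0 !addr0 exprS -mulrA -IH; congr (_ * _).
by apply: eq_expect => s _; rewrite !count_mem_rcons !addn0 !mark_rcons_neq.
Qed.

Lemma class_sum10 n phi : class_sum 1 0 n phi =
  p ^+ n * (q1 / p) * \sum_(a < n) phi a.+1 0%N.
Proof.
elim: n phi => [|n IH] phi; first by rewrite /class_sum /= mul0r big_ord0 mulr0.
rewrite /class_sum expect_rcons [X in _ + q2 * X]expect_eq0 => [|s]; last first.
  by rewrite !count_mem_rcons addn1 andbF mul0r.
have -> : expect p q1 q2 n (fun s =>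
    ((count_mem plus (rcons s None) == 1%N) && (count_mem minus (rcons s None) == 0%N))%:R
    * phi (mark plus (rcons s None)) (mark minus (rcons s None))) = class_sum 1 0 n phi.
  by apply: eq_expect => s _; rewrite !count_mem_rcons !addn0 !mark_rcons_neq.
have -> : expect p q1 q2 n (fun s =>
    ((count_mem plus (rcons s plus) == 1%N) && (count_mem minus (rcons s plus) == 0%N))%:R
    * phi (mark plus (rcons s plus)) (mark minus (rcons s plus))) =
    class_sum 0 0 n (fun _ b => phi n.+1 b).
  apply: eq_expect => s szs; rewrite !count_mem_rcons /= addn1 addn0 eqSS.
  case: eqP => [/eqP c|]; last by rewrite !mul0r.
  by rewrite mark_rcons_new // mark_rcons_neq // szs.
by rewrite IH class_sum00 big_ord_recr /= exprS; field.
Qed.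

Lemma class_sum01 n phi : class_sum 0 1 n phi =
  p ^+ n * (q2 / p) * \sum_(a < n) phi 0%N a.+1.
Proof.
elim: n phi => [|n IH] phi; first by rewrite /class_sum /= mul0r big_ord0 mulr0.
rewrite /class_sum expect_rcons [X in _ + q1 * X + _]expect_eq0 => [|s]; last first.
  by rewrite !count_mem_rcons addn1 mul0r.
have -> : expect p q1 q2 n (fun s =>
    ((count_mem plus (rcons s None) == 0%N) && (count_mem minus (rcons s None) == 1%N))%:R
    * phi (mark plus (rcons s None)) (mark minus (rcons s None))) = class_sum 0 1 n phi.
  by apply: eq_expect => s _; rewrite !count_mem_rcons !addn0 !mark_rcons_neq.
have -> : expect p q1 q2 n (fun s =>
    ((count_mem plus (rcons s minus) == 0%N) && (count_mem minus (rcons s minus) == 1%N))%:R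
    * phi (mark plus (rcons s minus)) (mark minus (rcons s minus))) =
    class_sum 0 0 n (fun a _ => phi a n.+1).
  apply: eq_expect => s szs; rewrite !count_mem_rcons /= addn1 addn0 eqSS andbC.
  case: eqP => [/eqP c|]; last by rewrite !mul0r.
  by rewrite mark_rcons_new // mark_rcons_neq // szs.
by rewrite IH class_sum00 big_ord_recr /= exprS; field.
Qed.

Lemma class_sum11 n phi : class_sum 1 1 n phi =
  p ^+ n * (q1 * q2 / p ^+ 2) *
  \sum_(c < n) \sum_(a < c) (phi a.+1 c.+1 + phi c.+1 a.+1).
Proof.
elim: n phi => [|n IH] phi; first by rewrite /class_sum /= mul0r big_ord0 mulr0.
rewrite /class_sum expect_rcons.
have -> : expect p q1 q2 n (fun s =>
    ((count_mem plus (rcons s None) == 1%N) && (count_mem minus (rcons s None) == 1%N))%:R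
    * phi (mark plus (rcons s None)) (mark minus (rcons s None))) = class_sum 1 1 n phi.
  by apply: eq_expect => s _; rewrite !count_mem_rcons !addn0 !mark_rcons_neq.
have -> : expect p q1 q2 n (fun s =>
    ((count_mem plus (rcons s plus) == 1%N) && (count_mem minus (rcons s plus) == 1%N))%:R
    * phi (mark plus (rcons s plus)) (mark minus (rcons s plus))) =
    class_sum 0 1 n (fun _ b => phi n.+1 b).
  apply: eq_expect => s szs; rewrite !count_mem_rcons /= addn1 addn0 eqSS.
  case: eqP => [/eqP c|]; last by rewrite !mul0r.
  by rewrite mark_rcons_new // mark_rcons_neq // szs.
have -> : expect p q1 q2 n (fun s =>
    ((count_mem plus (rcons s minus) == 1%N) && (count_mem minus (rcons s minus) == 1%N))%:R
    * phi (mark plus (rcons s minus)) (mark minus (rcons s minus))) =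
    class_sum 1 0 n (fun a _ => phi a n.+1).
  apply: eq_expect => s szs; rewrite !count_mem_rcons /= addn1 addn0 eqSS andbC.
  case: eqP => [/eqP c|]; last by rewrite !mul0r.
  by rewrite mark_rcons_new // mark_rcons_neq // szs.
rewrite IH class_sum01 class_sum10 big_ord_recr /= big_split /= (exprS _ n); field.
by [].
Qed.

Lemma expect_admissible n phi :
  expect p q1 q2 n (fun s => (admissible s)%:R * phi (mark plus s) (mark minus s)) =
  p ^+ n * (phi 0%N 0%N + q1 / p * \sum_(a < n) phi a.+1 0%N
    + q2 / p * \sum_(a < n) phi 0%N a.+1
    + q1 * q2 / p ^+ 2 * \sum_(c < n) \sum_(a < c) (phi a.+1 c.+1 + phi c.+1 a.+1)).
Proof.
transitivity (class_sum 0 0 n phi + class_sum 1 0 n phi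
  + class_sum 0 1 n phi + class_sum 1 1 n phi); last first.
  by rewrite class_sum00 class_sum10 class_sum01 class_sum11; ring.
rewrite /class_sum -!expectD; apply: eq_expect => s _; rewrite -!mulrDl.
congr (_ * _); rewrite /admissible -!natrD; congr (_%:R).
by case: (count_mem plus s) => [|[|?]]; case: (count_mem minus s) => [|[|?]].
Qed.

End Classes.

(** * Closed forms for the run and clump probabilities *)

Section ClosedForm.
Variables (R : realType) (p : R).
Hypotheses (p_neq0 : p != 0) (p_neq1 : 1 - p != 0).

Lemma run_prob_closed q1 q2 n : run_prob p q1 q2 n =
  p ^+ n * (1 + n%:R * (q1 + q2) / p + n%:R * (n%:R - 1) * (q1 * q2 / p ^+ 2)).
Proof.
rewrite /run_prob.
transitivity (expect p q1 q2 n (fun s => (admissible s)%:R * 1)).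
  by apply: eq_expect => s _; rewrite mulr1.
rewrite (expect_admissible q1 q2 p_neq0 n (fun _ _ => 1)).
have e1 : \sum_(a < n) 1 = n%:R :> R by rewrite sumr_const card_ord.
have e2 : \sum_(c < n) \sum_(a < c) (1 + 1) = n%:R * (n%:R - 1) :> R.
  elim: n {e1} => [|n IH]; first by rewrite big_ord0 mul0r.
  rewrite big_ord_recr /= IH sumr_const card_ord -mulr_natr -natr1; ring.
rewrite e1 e2; field.
by [].
Qed.

Variables (q1 q2 : R).

(* The arguments are marks: the older letter of the repeated sign has mark [a],
   the letter of the other sign has mark [b]. For [a = 0] the value is 0. *)
Definition survive (a b : nat) : R :=
  1 - (p ^+ a.-1 + a.-1%:R * (p ^+ (maxn a b).-1 / p) * q2).

(** For 0 < p < 1 this is the sum over all [a] of [1 - survive a.+1 0]; the tail from n on is p^n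
    times [single_const] plus n [single_slope]. *)
Definition single_const : R := 1 / (1 - p) + q2 / (1 - p) ^+ 2.
Definition single_slope : R := q2 / (p * (1 - p)).

Lemma survive_single_sum n :
  \sum_(a < n) survive a.+1 0 =
  n%:R - single_const + p ^+ n * (single_const + single_slope * n%:R).
Proof.
rewrite /single_const /single_slope; elim: n => [|n IH].
  by rewrite big_ord0 expr0; ring.
rewrite big_ord_recr /= IH /survive maxn0 /= -natr1 (exprS _ n); field.
by rewrite p_neq1.
Qed.

(* The coefficients solving the linear system that makes the closed form in
   [survive_pair_sum] telescope. *)
Definition pair_quad : R := 3 * q2 / (2 * p * (1 - p)).
Definition pair_slope : R := (2 * p * pair_quad + 1 - q2 / (2 * p)) / (1 - p).
Definition pair_const : R :=
  (p * pair_slope + p * pair_quad - 1 / (1 - p)) / (1 - p).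

Lemma survive_pair_sum n :
  \sum_(c < n) \sum_(a < c) (survive a.+1 c.+1 + survive c.+1 a.+1) =
  n%:R * (n%:R - 1) - n%:R / (1 - p) - pair_const
  + p ^+ n * (pair_const + pair_slope * n%:R + pair_quad * n%:R ^+ 2).
Proof.
(* With the later mark fixed, only one of the two summands depends on the earlier one, through a
   geometric and an arithmetic sum; [c] is the other, constant summand. *)
have inner c (k : R) m : \sum_(a < m) (1 - (p ^+ a + a%:R * k) + c) =
    m%:R * (1 + c) - (1 - p ^+ m) / (1 - p) - k * (m%:R * (m%:R - 1) / 2).
  elim: m => [|m IH]; first by rewrite big_ord0 expr0; field.
  by rewrite big_ord_recr /= IH -natr1 (exprS _ m); field.
rewrite /pair_const /pair_slope /pair_quad; elim: n => [|n IH].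
  by rewrite big_ord0 expr0; ring.
rewrite big_ord_recr /= IH.
rewrite (eq_bigr (fun a : 'I_n => 1 - (p ^+ a + a%:R * (p ^+ n / p * q2)) +
   (1 - (p ^+ n + n%:R * (p ^+ n / p) * q2)))); last first.
  move=> a _; rewrite /survive.
  have -> : maxn a.+1 n.+1 = n.+1 by have := ltn_ord a; lia.
  have -> : maxn n.+1 a.+1 = n.+1 by have := ltn_ord a; lia.
  by rewrite /=; ring.
rewrite inner -natr1 (exprS _ n); field.
by rewrite p_neq1.
Qed.

(** The probability of the breaking +1 itself is left out; [last_run_prob_split] restores it. *)
Definition resume_prob n : R :=
  expect p q1 q2 n.+1 (fun u => expect p q1 q2 n (fun v =>
    (admissible u && avoids n.+1 (behead (u ++ plus :: v)))%:R)).

Lemma resume_prob_closed n : p + q1 + q2 = 1 -> resume_prob n =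
  p ^+ n.+1 * (q1 / p * (n.+1%:R - single_const
     + p ^+ n.+1 * (single_const + single_slope * n.+1%:R))
   + q1 * q2 / p ^+ 2 * (n.+1%:R * (n.+1%:R - 1) - n.+1%:R / (1 - p) - pair_const
  + p ^+ n.+1 * (pair_const + pair_slope * n.+1%:R + pair_quad * n.+1%:R ^+ 2))).
Proof.
move=> pq1; rewrite -survive_single_sum -survive_pair_sum /resume_prob.
transitivity (expect p q1 q2 n.+1 (fun s =>
    (admissible s)%:R * survive (mark plus s) (mark minus s))).
  apply: eq_expect => u su; case: (boolP (admissible u)) => au; last first.
    by rewrite mul0r; apply: expect_eq0.
  rewrite mul1r /survive -(@expect_reappears _ _ q1 _ p_neq0 n); [|by []|]; last first.
    by have := mark_le_size plus u; have := mark_le_size minus u; rewrite su; lia.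
  rewrite -[X in X - _](expect_cst pq1 n) -expectB; apply: eq_expect => v sv.
  rewrite avoids_after_plus ?sv //; last by rewrite /= sv.
  by case: reappears; rewrite ?subrr ?subr0.
(* Words without +1 contribute nothing: the new +1 does not break their run, and [survive 0 b] is
   0. *)
rewrite (expect_admissible _ _ p_neq0) [X in q2 / p * X]big1 => [|a _].
  by rewrite /survive /= mul0r mul0r addr0 expr0 subrr; ring.
by rewrite /survive /= !mul0r addr0 expr0 subrr.
Qed.

End ClosedForm.

Lemma last_run_prob_split (R : realType) (p q1 q2 : R) n :
  last_run_prob p q1 q2 n.+1 =
  q1 * resume_prob p q1 q2 n + q2 * resume_prob p q2 q1 n.
Proof.
rewrite /last_run_prob expect_cat.
have -> : resume_prob p q2 q1 n = expect p q1 q2 n.+1 (fun u =>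
    expect p q1 q2 n (fun v =>
     (admissible u && avoids n.+1 (behead (u ++ minus :: v)))%:R)).
  rewrite /resume_prob -expect_flip; apply: eq_expect => u _.
  rewrite -expect_flip; apply: eq_expect => v _.
  rewrite admissible_flip; congr (_ && _)%:R.
  by rewrite -[RHS]avoids_flip /flip -!drop1 map_drop map_cat.
rewrite /resume_prob -!expectZ -expectD; apply: eq_expect => u su.
rewrite -[expect _ _ _ n.+1 _]/(p * _ + q1 * _ + q2 * _).
have r x v : size v = n -> run_at n.+1 (u ++ x :: v) = admissible u.
  by move=> sv; rewrite run_at_cat ?su // /run_at su leqnn take_oversize ?su.
rewrite [X in p * X](@eq_expect _ _ _ _ _ _ (fun=> 0)); last first.
  move=> v sv; rewrite r //; case: (boolP (admissible u)) => //= au.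
  by rewrite avoids_after_zero //= sv.
rewrite [X in p * X]expect_eq0 // mulr0 add0r.
congr (_ * _ + _ * _); apply: eq_expect => v sv; by rewrite r.
Qed.

Lemma last_run_prob_closed (R : realType) (p q1 q2 : R) :
  0 < p -> 0 < q1 -> 0 < q2 -> p + q1 + q2 = 1 ->
  exists A B D : R, forall n, (0 < n)%N ->
  last_run_prob p q1 q2 n = p ^+ n * (q1 * q2 / p ^+ 2) *
   (C0 q1 q2 * n%:R ^+ 2 + (C1 p q1 q2 - C0 q1 q2) * n%:R
    + (C2 p q1 q2 - C1 p q1 q2) + p ^+ n * (A + B * n%:R + D * n%:R ^+ 2)).
Proof.
move=> p0 q10 q20 pq1.
(* The witnesses are the coefficients of the p^n tails in [resume_prob_closed] for (q1, q2) and for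
   (q2, q1), weighted by the next letter and divided by q1 q2 / p^2. *)
exists (p * (q1 / q2 * single_const p q2 + q2 / q1 * single_const p q1)
  + q1 * pair_const p q2 + q2 * pair_const p q1).
exists (p * (q1 / q2 * single_slope p q2 + q2 / q1 * single_slope p q1)
  + q1 * pair_slope p q2 + q2 * pair_slope p q1).
exists (q1 * pair_quad p q2 + q2 * pair_quad p q1).
have p_neq0 : p != 0 by rewrite gt_eqF.
have p_neq1 : 1 - p != 0 by rewrite gt_eqF //; lra.
case=> // n _.
rewrite last_run_prob_split !resume_prob_closed //; last by rewrite addrAC.
have pq21 : p + q2 + q1 = 1 by rewrite addrAC.
rewrite /pair_const /pair_slope /pair_quad /single_const /single_slope /C0 /C1 /C2.
move: (n.+1%:R) (p ^+ n.+1) => N x.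
(* The forms of [C1] and [C2] match only under p + q1 + q2 = 1, so [q1] is eliminated before
   [field]. *)
have eq : q1 = 1 - p - q2 by lra.
have q2n : q2 != 0 by rewrite gt_eqF.
have q1n : 1 - p - q2 != 0 by rewrite -eq gt_eqF.
have pm : p - 1 != 0 by rewrite -opprB oppr_eq0.
rewrite eq; field.
by rewrite ?q2n ?q1n ?pm ?p_neq0 ?p_neq1.
Qed.

(** * Asymptotics of the rate *)

Section Taylor.
Variable R : realType.
Implicit Types y : R.

(** The remainder of ln at 1 after three terms. Its derivative collapses to the single term [df], so
    the mean value theorem gives a fourth-order bound. *)
Let f (t : R) : R := ln t - ((t - 1) - (t - 1) ^+ 2 / 2 + (t - 1) ^+ 3 / 3).
Let df (t : R) : R := - (t - 1) ^+ 3 / t.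

Let f_derive (t : R) : 0 < t -> is_derive t 1 f (df t).
Proof.
move=> t0; rewrite /f.
have dl := is_derive1_ln t0.
apply: is_derive_eq.
by rewrite /df /GRing.scale /=; field; rewrite gt_eqF.
Qed.

Let f_cont (a b : R) : 0 < a -> {within `[a, b], continuous f}.
Proof.
move=> a0; apply: derivable_within_continuous => t; rewrite in_itv /= => /andP[ta _].
by have [] := f_derive (lt_le_trans a0 ta).
Qed.

Let df_le (y c : R) : `|y| <= 1 / 2 -> 1 / 2 <= c -> `|c - 1| <= `|y| ->
  `|df c * y| <= 2 * `|y| ^+ 4.
Proof.
move=> y2 c2 cy; have c0 : 0 < c by lra.
rewrite normrM /df normrM normrN normfV normrX (gtr0_norm c0).
have -> : 2 * `|y| ^+ 4 = `|y| ^+ 3 * 2 * `|y| by ring.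
rewrite ler_wpM2r // ler_pM ?exprn_ge0 ?invr_ge0 ?(ltW c0) //.
  by rewrite lerXn2r ?nnegrE.
by rewrite -[leRHS]invrK lef_pV2 ?posrE //; lra.
Qed.

Lemma ln_taylor3 y : `|y| <= 1 / 2 ->
  `|ln (1 + y) - (y - y ^+ 2 / 2 + y ^+ 3 / 3)| <= 2 * `|y| ^+ 4.
Proof.
move=> y2; have yb := y2; rewrite ler_norml in yb.
have [yb1 yb2] := andP yb.
have f1 : f 1 = 0 by rewrite /f ln1; ring.
have fy : f (1 + y) = ln (1 + y) - (y - y ^+ 2 / 2 + y ^+ 3 / 3).
  have e : 1 + y - 1 = y by ring.
  by rewrite /f e.
rewrite -fy; have [y0|y0] := leP 0 y.
  have le1 : 1 <= 1 + y by rewrite lerDl.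
  have dr t : t \in `]1, 1 + y[ -> is_derive t 1 f (df t).
    by rewrite in_itv /= => /andP[t1 _]; apply: f_derive; lra.
  have [c] := MVT_segment le1 dr (f_cont ltr01).
  rewrite in_itv /= f1 subr0 => /andP[c1 c2] ->.
  rewrite [1 + y]addrC addrK; apply: df_le => //; first by lra.
  by rewrite !ger0_norm //; lra.
have le1 : 1 + y <= 1 by rewrite gerDl ltW.
have p0 : 0 < 1 + y by lra.
have dr t : t \in `]1 + y, 1[ -> is_derive t 1 f (df t).
  by rewrite in_itv /= => /andP[t1 _]; apply: f_derive; lra.
have [c] := MVT_segment le1 dr (f_cont p0).
rewrite in_itv /= f1 sub0r => /andP[c1 c2] e.
have -> : f (1 + y) = df c * y by rewrite -[LHS]opprK e; ring.
apply: df_le => //; first by lra.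
by rewrite !ler0_norm //; lra.
Qed.

(** The fourth power serves three times: (ln L)^4 against L, 1/p^n against n^4, and (ln N)^4 against
    N. Each factor 24 below comes from here. *)
Lemma expR_lower (x : R) : 0 <= x -> x ^+ 4 / 24 <= expR x.
Proof. by move=> /(@expR_ge1Dxn R _ 3) => h; apply: le_trans h; rewrite lerDr. Qed.

Lemma expR_near1 (y : R) : `|y| <= 1 / 2 -> `|expR y - 1| <= 2 * `|y|.
Proof.
move=> y2; have := y2; rewrite ler_norml => /andP[y_lo y_hi].
have h1 := expR_ge1Dx y; have := expR_ge1Dx (- y); rewrite expRN => h2.
have e0 := expR_gt0 y.
have h3 : expR y * (1 - y) <= 1.
  by rewrite -ler_pdivlMl // mulr1 (le_trans _ h2).
have h4 : - `|y| <= y by rewrite lerNnormlW.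
have h5 : y <= `|y| by exact: ler_norm.
have h6 : expR y * (1 / 2) <= expR y * (1 - y) by rewrite ler_wpM2l ?expR_ge0 //; lra.
have h7 : (expR y - 1) * 1 <= expR y * y by lra.
have [y0|y0] := leP 0 y; rewrite ler_norml; apply/andP; split; try lra.
  rewrite ger0_norm // in h4 h5 *.
  have : expR y * y <= 2 * y by rewrite ler_wpM2r //; lra.
  by lra.
have : expR y <= 1 by rewrite -[leRHS]expR0 ler_expR ltW.
by have := normr_ge0 y; lra.
Qed.

End Taylor.

(** * Calculus of orders of magnitude *)

Section Order.
Variables (R : realType) (tau : nat -> R).
Hypothesis tau01 : \forall N \near \oo, 0 <= tau N <= 1.
Implicit Types f g : nat -> R.

(** The gauge [tau] is later [scale p], for expansions in N, or 1/n, for the expansion of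
    [last_run_prob] in n. *)
Definition Opow (d : nat) (f : nat -> R) : Prop :=
  exists k : R, \forall N \near \oo, `|f N| <= k * tau N ^+ d.

Lemma Opow_near d f g :
  (\forall N \near \oo, f N = g N) -> Opow d f -> Opow d g.
Proof.
by move=> fg [k fk]; exists k; apply: filterS2 fg fk => N <-.
Qed.

Lemma OpowD d f g : Opow d f -> Opow d g -> Opow d (fun N => f N + g N).
Proof.
move=> [k fk] [k' gk]; exists (k + k'); apply: filterS2 fk gk => N h1 h2.
by rewrite mulrDl (le_trans (ler_normD _ _)) // lerD.
Qed.

Lemma OpowN d f : Opow d f -> Opow d (fun N => - f N).
Proof. by move=> [k fk]; exists k; apply: filterS fk => N; rewrite normrN. Qed.

Lemma OpowB d f g : Opow d f -> Opow d g -> Opow d (fun N => f N - g N).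
Proof. by move=> hf hg; apply: OpowD => //; apply: OpowN. Qed.

Lemma OpowM i j f g : Opow i f -> Opow j g -> Opow (i + j) (fun N => f N * g N).
Proof.
move=> [k fk] [k' gk]; exists (k * k'); apply: filterS2 fk gk => N h1 h2.
by rewrite normrM exprD mulrACA ler_pM.
Qed.

Lemma Opow_cst c : Opow 0 (fun=> c).
Proof. by exists `|c|; apply: nearW => N; rewrite mulr1. Qed.

Lemma OpowZ d c f : Opow d f -> Opow d (fun N => c * f N).
Proof. by move=> /(OpowM (Opow_cst c)). Qed.

Lemma OpowX i j f : Opow i f -> Opow (i * j) (fun N => f N ^+ j).
Proof.
move=> hf; elim: j => [|j IH]; first by rewrite muln0; exact: Opow_cst.
rewrite mulnS; apply: Opow_near (OpowM hf IH).
by apply: nearW => N; rewrite exprS.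
Qed.

Lemma Opow_weaken i j f : (j <= i)%N -> Opow i f -> Opow j f.
Proof.
move=> ji [k fk]; exists `|k|; apply: filterS2 fk tau01 => N fN /andP[t0 t1].
apply: (le_trans fN); apply: (@le_trans _ _ (`|k| * tau N ^+ i)).
  by rewrite ler_wpM2r ?exprn_ge0 ?ler_norm.
by rewrite ler_wpM2l // ler_wiXn2l.
Qed.

Lemma Opow_monomial c (f g : nat -> R) i j : Opow 1 f -> Opow 1 g ->
  Opow 0 c -> Opow (i + j) (fun N => c N * (f N ^+ i * g N ^+ j)).
Proof.
move=> /(OpowX i) hf /(OpowX j) hg hc; rewrite !mul1n in hf hg.
exact: OpowM hc (OpowM hf hg).
Qed.

End Order.

Section Scale.
Variables (R : realType) (p : R).
Hypotheses (p_gt0 : 0 < p) (p_lt1 : p < 1).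

Lemma C_gt0 : 0 < C p.
Proof. by rewrite ln_gt0 // invf_gt1. Qed.

Lemma near_ln_ge (M : R) : \forall N \near \oo, M <= ln (N%:R : R).
Proof.
near=> N; have : expR M <= N%:R by near: N; exact: nbhs_infty_ger.
move=> h; have N0 : 0 < N%:R :> R by rewrite (lt_le_trans (expR_gt0 M)).
by rewrite -ler_expR lnK ?posrE.
Unshelve. all: by end_near. Qed.

Lemma near_logp_ge (M : R) : \forall N \near \oo, M <= logp p (N%:R : R).
Proof.
apply: filterS (near_ln_ge (M * C p)) => N h.
by rewrite ler_pdivlMr //; exact: C_gt0.
Qed.

(* Every correction term in [m] and [H] is a monomial in 1/log N and
   loglog N/log N. With [scale] their sum, an error O(scale^4) is
   O(1/(log N)^3), so it suffices to expand to total degree 3. *)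
Definition scale (N : nat) : R :=
  (logp p N%:R)^-1 + logp p (logp p N%:R) / logp p N%:R.

Lemma logp_ge0 x : 1 <= x -> 0 <= logp p x.
Proof. by move=> x1; apply: divr_ge0; [exact: ln_ge0 | exact: ltW C_gt0]. Qed.

Lemma scale_ge0 N : 1 <= logp p (N%:R : R) -> 0 <= scale N.
Proof.
move=> h; have L0 := le_trans ler01 h.
by apply: addr_ge0; [rewrite invr_ge0 | apply: divr_ge0 => //; exact: logp_ge0].
Qed.

(** [scale] is (1 + l)/L with l = log L, and l^4 = O(L) uses up one of the four powers of L. *)
Lemma scale4_le : exists2 k : R, 0 < k & forall N, 1 <= logp p (N%:R : R) ->
  scale N ^+ 4 <= k * (logp p N%:R)^-1 ^+ 3.
Proof.
exists (8 * (1 + 24 / C p ^+ 4)).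
  by rewrite mulr_gt0 // addr_gt0 // divr_gt0 // exprn_gt0 // C_gt0.
move=> N; rewrite /scale; set L := logp p _ => L1.
have L0 : 0 < L by lra.
have c0 := C_gt0; have C4 : 0 < C p ^+ 4 by rewrite exprn_gt0.
set l := logp p L; have l0 : 0 <= l by exact: logp_ge0.
have lnL : ln L = C p * l by rewrite /l /logp -/(C p); field; rewrite gt_eqF.
have lb : l ^+ 4 <= 24 / C p ^+ 4 * L.
  have : ln L ^+ 4 / 24 <= L.
    by rewrite -[leRHS]lnK ?posrE // expR_lower // ln_ge0.
  rewrite lnL exprMn => h.
  by rewrite mulrAC ler_pdivlMr //; lra.
have s : (1 + l) ^+ 4 <= 8 * (1 + l ^+ 4).
  (* This is 8(1 + l^4) - (1 + l)^4 in factored form. *)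
  have : 0 <= (l - 1) ^+ 2 * (7 * l ^+ 2 + 10 * l + 7).
    by rewrite mulr_ge0 ?sqr_ge0 //; nra.
  by lra.
have -> : L^-1 + l / L = (1 + l) * L^-1 by rewrite mulrDl mul1r.
rewrite exprMn [_^-1 ^+ 4]exprS mulrA ler_wpM2r ?exprn_ge0 ?invr_ge0 ?(ltW L0) //.
rewrite ler_pdivrMr //; apply: (le_trans s); rewrite -mulrA ler_wpM2l //.
by rewrite mulrDl mul1r lerD.
Qed.

Lemma near_scale_le (eps : R) : 0 < eps ->
  \forall N \near \oo, 0 <= scale N <= eps.
Proof.
move=> eps0; have [k k0 kP] := scale4_le.
apply: filterS2 (near_logp_ge 1) (near_logp_ge (k / eps ^+ 4)) => N L1 Lk.
have s0 := scale_ge0 L1; rewrite s0 /=.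
rewrite -(@ler_pXn2r _ 4) ?nnegrE ?(ltW eps0) //.
apply: (le_trans (kP _ L1)); set L := logp _ _ in L1 Lk *.
have L0 : 0 < L by lra.
have e4 : 0 < eps ^+ 4 by rewrite exprn_gt0.
apply: (@le_trans _ _ (k * L^-1)).
  rewrite ler_wpM2l ?(ltW k0) // exprS ler_piMr ?invr_ge0 ?(ltW L0) //.
  by rewrite exprn_ile1 // ?invr_ge0 ?(ltW L0) // invf_le1.
by rewrite ler_pdivrMr // mulrC -ler_pdivrMr.
Qed.

End Scale.

Section Remainders.
Variables (R : realType) (tau : nat -> R).
Hypothesis tau_small : forall eps, 0 < eps -> \forall N \near \oo, 0 <= tau N <= eps.

Let tau01 : \forall N \near \oo, 0 <= tau N <= 1.
Proof. exact: tau_small. Qed.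

Lemma Opow_small d f : Opow tau 1 f -> 0 < d -> \forall N \near \oo, `|f N| <= d.
Proof.
move=> [k fk] d0; have k1 : 0 < `|k| + 1 by rewrite ltr_wpDl.
apply: filterS2 fk (tau_small (divr_gt0 d0 k1)) => N h /andP[t0 t1].
apply: (le_trans h); rewrite expr1.
apply: (@le_trans _ _ ((`|k| + 1) * tau N)).
  by rewrite ler_wpM2r // (le_trans (ler_norm k)) // lerDl.
by rewrite mulrC -ler_pdivlMr.
Qed.

Lemma Opow_ln_remainder (y : nat -> R) : Opow tau 1 y ->
  Opow tau 4 (fun N => ln (1 + y N) - (y N - y N ^+ 2 / 2 + y N ^+ 3 / 3)).
Proof.
move=> hy; have half : 0 < 1 / 2 :> R by lra.
have sm := Opow_small hy half; have [k hk] := OpowX 4 hy.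
exists (2 * k); apply: filterS2 sm hk => N h1; rewrite mul1n normrX => h2.
by rewrite (le_trans (ln_taylor3 h1)) // -mulrA ler_wpM2l.
Qed.

Lemma Opow_inv (y : nat -> R) : Opow tau 1 y -> Opow tau 0 (fun N => (1 + y N)^-1).
Proof.
move=> hy; have half : 0 < 1 / 2 :> R by lra.
exists 2; apply: filterS (Opow_small hy half) => N.
rewrite ler_norml => /andP[h1 h2]; rewrite mulr1 ger0_norm ?invr_ge0; last by lra.
by rewrite -[leRHS]invrK lef_pV2 ?posrE ?invr_gt0 //; lra.
Qed.

Lemma Opow_inv_remainder (y : nat -> R) : Opow tau 1 y ->
  Opow tau 3 (fun N => (1 + y N)^-1 - (1 - y N + y N ^+ 2)).
Proof.
move=> hy; have half : 0 < 1 / 2 :> R by lra.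
have := OpowN (OpowM (OpowX 3 hy) (Opow_inv hy)).
apply: Opow_near; apply: filterS (Opow_small hy half) => N.
rewrite ler_norml => /andP[h1 h2]; field.
by rewrite gt_eqF //; lra.
Qed.

Lemma Opow_inv2_remainder (y : nat -> R) : Opow tau 1 y ->
  Opow tau 2 (fun N => (1 + y N)^-1 ^+ 2 - (1 - 2 * y N)).
Proof.
move=> hy; have half : 0 < 1 / 2 :> R by lra.
(* (1 + y)^-2 - (1 - 2y) = y^2 (3 + 2y)(1 + y)^-2. *)
have h3 : Opow tau 0 (fun N => 3 + 2 * y N).
  apply: OpowD; first exact: Opow_cst.
  by apply: OpowZ; exact: Opow_weaken hy.
have := OpowM (OpowM (OpowX 2 hy) h3) (OpowX 2 (Opow_inv hy)).
apply: Opow_near; apply: filterS (Opow_small hy half) => N.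
rewrite ler_norml => /andP[h1 h2]; field.
by rewrite gt_eqF //; lra.
Qed.

End Remainders.

(** * Expansion of the exponent at n = m + x *)

Section Expansion.
Variables (R : realType) (p q1 q2 : R).
Hypotheses (p_gt0 : 0 < p) (p_lt1 : p < 1).
Hypotheses (q1_gt0 : 0 < q1) (q2_gt0 : 0 < q2).

Let c := C p.
Let a := (C1 p q1 q2 - C0 q1 q2) / (C p * C0 q1 q2).
Let kk := K p q1 q2.
Let e N : R := (logp p (N%:R : R))^-1.
Let w N : R := logp p (logp p (N%:R : R)) / logp p N%:R.
Local Notation Opow := (Opow (scale p)).

Let c_neq0 : c != 0. Proof. by rewrite gt_eqF // C_gt0. Qed.
Let C0_neq0 : C0 q1 q2 != 0. Proof. by rewrite gt_eqF // addr_gt0. Qed.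

Let small (eps : R) : 0 < eps -> \forall N \near \oo, 0 <= scale p N <= eps.
Proof. exact: near_scale_le. Qed.
Let s01 : \forall N \near \oo, 0 <= scale p N <= 1.
Proof. exact: small. Qed.

Let Opow_e : Opow 1 e.
Proof.
exists 1; apply: filterS (near_logp_ge p_gt0 p_lt1 1) => N L1.
have L0 := le_trans ler01 L1.
rewrite mul1r expr1 ger0_norm ?invr_ge0 // /scale lerDl.
by apply: divr_ge0 => //; exact: logp_ge0.
Qed.

Let Opow_w : Opow 1 w.
Proof.
exists 1; apply: filterS (near_logp_ge p_gt0 p_lt1 1) => N L1.
have L0 := le_trans ler01 L1.
rewrite mul1r expr1 ger0_norm; last by apply: divr_ge0 => //; exact: logp_ge0.
by rewrite /scale lerDr invr_ge0.
Qed.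

(* The homogeneous components of [m N], with w = loglog N/log N and e = 1/log N. *)
Let m2 N := 4 / c * (w N ^+ 1 * e N ^+ 0) + a * (w N ^+ 0 * e N ^+ 1).
Let m3 N := - (4 / c) * (w N ^+ 2 * e N ^+ 0)
  + (8 / c ^+ 2 - 2 * a) * (w N ^+ 1 * e N ^+ 1)
  + (2 * a / c + kk) * (w N ^+ 0 * e N ^+ 2).
Let m4 N := 16 / (3 * c) * (w N ^+ 3 * e N ^+ 0)
  + (4 * a - 24 / c ^+ 2) * (w N ^+ 2 * e N ^+ 1)
  + (16 / c ^+ 3 - 4 * kk - 12 * a / c) * (w N ^+ 1 * e N ^+ 2).

Let om i j (k : R) : Opow (i + j) (fun N => k * (w N ^+ i * e N ^+ j)).
Proof. exact: (@Opow_monomial _ _ (fun=> k) w e i j Opow_w Opow_e (Opow_cst _ _)). Qed.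

Let Opow_m2 : Opow 1 m2.
Proof. by apply: OpowD; [exact: (om 1 0) | exact: (om 0 1)]. Qed.
Let Opow_m3 : Opow 2 m3.
Proof. by apply: OpowD; [apply: OpowD; [exact: (om 2 0) | exact: (om 1 1)] | exact: (om 0 2)]. Qed.
Let Opow_m4 : Opow 3 m4.
Proof. by apply: OpowD; [apply: OpowD; [exact: (om 3 0) | exact: (om 2 1)] | exact: (om 1 2)]. Qed.

(** [m] lists some monomials of degree three twice; merging them gives -24 = -16 - 8 and -12 = -8 -
    4 in [m4]. *)
Lemma m_expansion : \forall N \near \oo,
  m p q1 q2 N = logp p N%:R + 2 * logp p (logp p N%:R) + m2 N + m3 N + m4 N.
Proof.
apply: filterS (near_logp_ge p_gt0 p_lt1 1) => N L1.
rewrite /m /m2 /m3 /m4 /w /e /a /kk -/c.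
move: (logp p N%:R) L1 (logp p (logp p N%:R)) => L L1 l.
have L0 : L != 0 by rewrite gt_eqF //; lra.
move: (K _ _ _) (C1 _ _ _) (C0 _ _) c c_neq0 C0_neq0 => kk' C1' C0' c' hc hC0.
by field; rewrite hc hC0 L0.
Qed.

Lemma near_m_ge (M : R) : \forall N \near \oo, M <= m p q1 q2 N.
Proof.
have h : Opow 1 (fun N => m2 N + (m3 N + m4 N)).
  apply: OpowD => //; apply: OpowD; first exact: (Opow_weaken s01 _ Opow_m3).
  exact: (Opow_weaken s01 _ Opow_m4).
apply: filterS3 (near_logp_ge p_gt0 p_lt1 (`|M| + 1)) m_expansion (Opow_small small h ltr01).
move=> N L1 ->; rewrite ler_norml => /andP[h1 h2].
have l0 : 0 <= logp p (logp p (N%:R : R)).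
  by apply: logp_ge0 => //; rewrite (le_trans _ L1) // lerDr.
by have := ler_norm M; lra.
Qed.

Variables (n : nat -> nat) (x : nat -> R).
Hypothesis Opow_x : Opow 0 x.
Hypothesis nE : \forall N \near \oo, (n N)%:R = m p q1 q2 N + x N.

(** [y] is n/L - 1. Division by L turns the components of n into [d1], ..., [d4], where [di] has
    degree i; the bounded [x] enters at degree one. *)
Let d1 N := 2 * w N + x N * e N.
Let d2 N := e N * m2 N.
Let d3 N := e N * m3 N.
Let d4 N := e N * m4 N.
Let y N := d1 N + d2 N + d3 N + d4 N.

Let Opow_d1 : Opow 1 d1.
Proof. by apply: OpowD; [exact: OpowZ | exact: (OpowM Opow_x Opow_e)]. Qed.
Let Opow_d2 : Opow 2 d2. Proof. exact: OpowM Opow_e Opow_m2. Qed.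
Let Opow_d3 : Opow 3 d3. Proof. exact: OpowM Opow_e Opow_m3. Qed.
Let Opow_d4 : Opow 4 d4. Proof. exact: OpowM Opow_e Opow_m4. Qed.

Let r3 N := d3 N + d4 N.
Let Opow_r3 : Opow 3 r3.
Proof. by apply: OpowD => //; exact: (Opow_weaken s01 _ Opow_d4). Qed.
Let r2 N := d2 N + r3 N.
Let Opow_r2 : Opow 2 r2.
Proof. by apply: OpowD => //; exact: (Opow_weaken s01 _ Opow_r3). Qed.
Let Opow_y : Opow 1 y.
Proof.
have h : Opow 1 (fun N => d1 N + r2 N).
  by apply: OpowD => //; exact: (Opow_weaken s01 _ Opow_r2).
by apply: Opow_near h; apply: nearW => N; rewrite /y /r2 /r3; ring.
Qed.

Lemma nat_expansion : \forall N \near \oo,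
  (n N)%:R = logp p (N%:R : R) * (1 + y N).
Proof.
apply: filterS3 (near_logp_ge p_gt0 p_lt1 1) m_expansion nE => N L1 mE ->.
rewrite mE /y /d1 /d2 /d3 /d4 /w /e.
move: (logp p N%:R) L1 (logp p (logp p N%:R)) (m2 N) (m3 N) (m4 N) => L L1 l *.
have L0 : L != 0 by rewrite gt_eqF //; lra.
by field.
Qed.

(** In the square of [y], only d1^2 and 2 d1 d2 have degree below four. *)
Let sq_remainder : Opow 4 (fun N => y N ^+ 2 - (d1 N ^+ 2 + 2 * d1 N * d2 N)).
Proof.
have h : Opow 4 (fun N => d2 N ^+ 2 + (2 * (d1 N * r3 N) + r3 N * (2 * d2 N + r3 N))).
  apply: OpowD; first exact: (OpowX 2 Opow_d2).
  apply: OpowD; first exact: OpowZ (OpowM Opow_d1 Opow_r3).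
  apply: (Opow_weaken s01 (isT : 4 <= 3 + 2)%N); apply: OpowM => //.
  by apply: OpowD; [exact: OpowZ | exact: (Opow_weaken s01 _ Opow_r3)].
by apply: Opow_near h; apply: nearW => N; rewrite /y /r3; ring.
Qed.

Let cube_remainder : Opow 4 (fun N => y N ^+ 3 - d1 N ^+ 3).
Proof.
have h1 : Opow 2 (fun N => 3 * d1 N ^+ 2 + (3 * (d1 N * r2 N) + r2 N ^+ 2)).
  apply: OpowD; first exact: OpowZ (OpowX 2 Opow_d1).
  apply: OpowD.
    by apply: OpowZ; exact: (Opow_weaken s01 _ (OpowM Opow_d1 Opow_r2)).
  exact: (Opow_weaken s01 _ (OpowX 2 Opow_r2)).
have := OpowM Opow_r2 h1; apply: Opow_near; apply: nearW => N.
by rewrite /y /r2 /r3; ring.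
Qed.

Let inv_remainder : Opow 4 (fun N =>
  e N * ((1 + y N)^-1 - (1 - d1 N - d2 N + d1 N ^+ 2))).
Proof.
apply: (OpowM Opow_e).
have h1 : Opow 3 (fun N => r2 N * (2 * d1 N + r2 N)).
  apply: (OpowM Opow_r2).
  by apply: OpowD; [exact: OpowZ | exact: (Opow_weaken s01 _ Opow_r2)].
have := OpowD (Opow_inv_remainder small Opow_y) (OpowB h1 Opow_r3).
by apply: Opow_near; apply: nearW => N; rewrite /y /r2 /r3; ring.
Qed.

Let inv2_remainder : Opow 4 (fun N =>
  e N ^+ 2 * ((1 + y N)^-1 ^+ 2 - (1 - 2 * d1 N))).
Proof.
apply: (OpowM (OpowX 2 Opow_e)).
have := OpowB (Opow_inv2_remainder small Opow_y) (OpowZ 2 Opow_r2).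
by apply: Opow_near; apply: nearW => N; rewrite /y /r2 /r3; ring.
Qed.

(** All that is dropped at degree four: Taylor remainders of ln(1 + y), 1/(1 + y) and 1/(1 + y)^2,
    and truncations of y, y^2 and y^3. *)
Let rem N :=
  2 / c * ((ln (1 + y N) - (y N - y N ^+ 2 / 2 + y N ^+ 3 / 3)) + d4 N
    - 1 / 2 * (y N ^+ 2 - (d1 N ^+ 2 + 2 * d1 N * d2 N))
    + 1 / 3 * (y N ^+ 3 - d1 N ^+ 3))
  + a * (e N * ((1 + y N)^-1 - (1 - d1 N - d2 N + d1 N ^+ 2)))
  + kk * (e N ^+ 2 * ((1 + y N)^-1 ^+ 2 - (1 - 2 * d1 N))).

Let Opow_rem : Opow 4 rem.
Proof.
apply: OpowD; last exact: OpowZ.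
apply: OpowD; last exact: OpowZ.
apply: OpowZ; apply: OpowD; last exact: OpowZ.
apply: OpowB; last exact: OpowZ.
by apply: OpowD => //; exact: Opow_ln_remainder.
Qed.

(* All terms of degree at most 3 cancel, except those in 1/(log N)^3. *)
Let cubic N : R := 2 / c * (2 * a / c + kk - a * x N + x N ^+ 3 / 3)
  + a * x N ^+ 2 - a ^+ 2 - 2 * kk * x N.

Let Opow_cubic : Opow 0 cubic.
Proof.
have ox := OpowX 2 Opow_x; have ox3 := OpowX 3 Opow_x.
have h : Opow 0 (fun N => 2 / c * (2 * a / c + kk) - a ^+ 2 +
   (- (2 / c * a) - 2 * kk) * x N + (a * x N ^+ 2 + 2 / c / 3 * x N ^+ 3)).
  apply: OpowD; last by apply: OpowD; exact: OpowZ.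
  by apply: OpowD; [exact: Opow_cst | exact: OpowZ].
by apply: Opow_near h; apply: nearW => N; rewrite /cubic; ring.
Qed.

(** The terms before [H] form log(N lam / amp) up to O(n^-3). [m] was chosen to cancel their part
    free of [x], and [H] is the part depending on [x]. *)
Lemma exponent_expansion : exists k : R, \forall N \near \oo,
  `|logp p (N%:R : R) - (n N)%:R + 2 / C p * ln (n N)%:R
    + (C1 p q1 q2 - C0 q1 q2) / (C p * C0 q1 q2) * (n N)%:R^-1
    + K p q1 q2 * (n N)%:R^-1 ^+ 2 - H p q1 q2 N (x N)|
  <= k * (logp p (N%:R : R))^-1 ^+ 3.
Proof.
have [k1 hk1] := Opow_rem; have [k2 hk2] := Opow_cubic.
have [k3 k3_gt0 hk3] := scale4_le p_gt0 p_lt1.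
exists (k2 + `|k1| * k3).
have half : 0 < 1 / 2 :> R by lra.
apply: filterS3 (near_logp_ge p_gt0 p_lt1 1) (Opow_small small Opow_y half)
  (filterI nE (filterI m_expansion (filterI nat_expansion (filterI hk1 hk2)))).
move=> N L1; rewrite ler_norml => /andP[y1 y2] [n1 [mE [n2 [h1 h2]]]].
set E := (X in `|X| <= _).
have -> : E = e N ^+ 3 * cubic N + rem N.
  rewrite /E; set Lg := logp p N%:R in L1 n2 mE *.
  have L0 : 0 < Lg by lra.
  have y0 : 0 < 1 + y N by lra.
  have -> : ln (n N)%:R = c * logp p Lg + ln (1 + y N).
    rewrite n2 lnM ?posrE //; congr (_ + _).
    by rewrite /logp -/(C p) -/c mulrC divfK.
  have -> : (n N)%:R^-1 = e N * (1 + y N)^-1 by rewrite n2 invfM.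
  rewrite [X in _ - X + 2 / _ * _]n1 mE.
  rewrite -/c -/kk -/a /rem.
  have -> : H p q1 q2 N (x N) = - x N + 2 / c * (e N * x N)
    - 4 / c * (w N * e N) * x N - a * e N ^+ 2 * x N
    + (4 * a - 8 / c ^+ 2) * (w N * e N ^+ 2) * x N
    + 8 / c * (w N ^+ 2 * e N) * x N
    - 1 / c * e N ^+ 2 * x N ^+ 2 + 4 / c * (w N * e N ^+ 2) * x N ^+ 2.
    rewrite /H /w /e /a -/c -/Lg.
    have L0' : Lg != 0 by rewrite gt_eqF.
    by field; rewrite c_neq0 C0_neq0 L0'.
  (* These values can be made opaque: [rem] contains them with the same coefficients, so what
     remains is an identity of rational functions. *)
  move: (ln _) ((1 + y N)^-1) => ly iy.
  rewrite exprMn /y /d4 /d3 /d2 /d1 /cubic /m2 /m3 /m4.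
  move: (logp p Lg) (w N) (e N) (x N) a kk c c_neq0 => l' w' e' x' a' k' c' hc.
  by field.
have e0 : 0 <= e N by rewrite invr_ge0; lra.
apply: (le_trans (ler_normD _ _)); rewrite mulrDl lerD //.
  rewrite normrM ger0_norm ?exprn_ge0 // mulrC ler_wpM2r ?exprn_ge0 //.
  by move: h2; rewrite mulr1.
apply: (le_trans h1); apply: (@le_trans _ _ (`|k1| * scale p N ^+ 4)).
  by rewrite ler_wpM2r ?ler_norm // exprn_ge0 // scale_ge0.
by rewrite -mulrA ler_wpM2l // hk3.
Qed.

(** Transfers estimates between n and log N. *)
Lemma nat_bounds : \forall N \near \oo,
  logp p (N%:R : R) / 2 <= (n N)%:R <= 2 * logp p (N%:R : R).
Proof.
have half : 0 < 1 / 2 :> R by lra.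
apply: filterS3 (near_logp_ge p_gt0 p_lt1 1) nat_expansion
  (Opow_small small Opow_y half) => N L1 ->.
rewrite ler_norml => /andP[y1 y2]; set L := logp p _ in L1 *.
have h1 : L * (1 / 2) <= L * (1 + y N) by rewrite ler_wpM2l; lra.
have h2 : L * (1 + y N) <= L * 2 by rewrite ler_wpM2l; lra.
by apply/andP; split; lra.
Qed.

Lemma Opow_H : Opow 0 (fun N => H p q1 q2 N (x N)).
Proof.
have o k i j : Opow 0 (fun N => k * (w N ^+ i * e N ^+ j)).
  exact: (Opow_weaken s01 (leq0n (i + j)) (om i j k)).
have h : Opow 0 (fun N => - x N
    + (2 / c * (w N ^+ 0 * e N ^+ 1) - 4 / c * (w N ^+ 1 * e N ^+ 1)
     - a * (w N ^+ 0 * e N ^+ 2) + (4 * a - 8 / c ^+ 2) * (w N ^+ 1 * e N ^+ 2)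
     + 8 / c * (w N ^+ 2 * e N ^+ 1)) * x N
    + (4 / c * (w N ^+ 1 * e N ^+ 2) - 1 / c * (w N ^+ 0 * e N ^+ 2)) * x N ^+ 2).
  apply: OpowD; last exact: OpowM (OpowB (o _ _ _) (o _ _ _)) (OpowX 2 Opow_x).
  apply: OpowD; first exact: OpowN.
  apply: (@OpowM _ _ 0 0) => //.
  by apply: OpowD => //; apply: OpowD => //; apply: OpowB => //; apply: OpowB.
apply: Opow_near h; apply: filterS (near_logp_ge p_gt0 p_lt1 1) => N L1.
have L0 : logp p N%:R != 0 by rewrite gt_eqF // (lt_le_trans ltr01).
by rewrite /H /w /e /a -/c; field; rewrite c_neq0 C0_neq0 L0.
Qed.

End Expansion.

Lemma near_and (A B : nat -> Prop) :
  (\forall N \near \oo, A N) -> (\forall N \near \oo, B N) ->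
  \forall N \near \oo, A N /\ B N.
Proof. by move=> hA hB; apply: filterS2 hA hB. Qed.

(** * Asymptotics of the avoidance probability *)

Section Asymptotics.
Variables (R : realType) (p q1 q2 : R).
Hypotheses (p_gt0 : 0 < p) (q1_gt0 : 0 < q1) (q2_gt0 : 0 < q2).
Hypothesis pq1 : p + q1 + q2 = 1.

Let p_lt1 : p < 1. Proof. by rewrite -[ltRHS]pq1 -addrA ltrDl addr_gt0. Qed.
Let c := C p.
Let c_gt0 : 0 < c. Proof. exact: C_gt0. Qed.
Let amp := C0 q1 q2 * p ^- 2 * q1 * q2.
Let C0_gt0 : 0 < C0 q1 q2. Proof. exact: addr_gt0. Qed.
Let amp_gt0 : 0 < amp.
Proof. by rewrite !mulr_gt0 // invr_gt0 exprn_gt0. Qed.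

Let inv (n : nat) : R := n%:R^-1.

Let inv_small (eps : R) : 0 < eps -> \forall n \near \oo, 0 <= inv n <= eps.
Proof.
move=> eps0; apply: filterS (nbhs_infty_ger eps^-1) => n h.
have n0 : 0 < n%:R :> R by rewrite (lt_le_trans _ h) // invr_gt0.
by rewrite invr_ge0 ler0n -[leRHS]invrK lef_pV2 ?posrE ?invr_gt0.
Qed.
Let inv01 : \forall n \near \oo, 0 <= inv n <= 1. Proof. exact: inv_small. Qed.

Let Opow_inv1 : Opow inv 1 inv.
Proof. by exists 1; apply: nearW => n; rewrite mul1r expr1 ger0_norm ?invr_ge0. Qed.

Lemma exprn_expR n : p ^+ n = expR (- (c * n%:R)).
Proof.
rewrite /c /C lnV ?posrE // mulNr opprK mulrC -powR_mulrn ?ltW //.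
by rewrite /powR gt_eqF.
Qed.

Let Opow_exprn : Opow inv 4 (fun n => p ^+ n).
Proof.
exists (24 / c ^+ 4); apply: filterS (nbhs_infty_gtr (0 : R)) => n n0.
rewrite exprn_expR ger0_norm ?expR_ge0 // expRN /inv exprVn.
have h : 0 < (c * n%:R) ^+ 4 / 24 by rewrite divr_gt0 // exprn_gt0 // mulr_gt0.
have -> : 24 / c ^+ 4 / n%:R ^+ 4 = ((c * n%:R) ^+ 4 / 24)^-1.
  by field; rewrite !gt_eqF.
rewrite lef_pV2 ?posrE ?expR_gt0 //; apply: expR_lower.
by rewrite mulr_ge0 ?ler0n ?(ltW c_gt0).
Qed.

(** [k1] and [k2] are the coefficients of 1/n and 1/n^2 once the quadratic factor of
    [last_run_prob_closed] is divided by C0 n^2. *)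
Let k1 := (C1 p q1 q2 - C0 q1 q2) / C0 q1 q2.
Let k2 := (C2 p q1 q2 - C1 p q1 q2) / C0 q1 q2.

Lemma last_run_prob_expansion :
  exists z : nat -> R, [/\ Opow inv 1 z,
    \forall n \near \oo, last_run_prob p q1 q2 n =
       p ^+ n * amp * n%:R ^+ 2 * (1 + z n) &
    Opow inv 3 (fun n => ln (1 + z n)
      - (k1 * inv n + c * K p q1 q2 * inv n ^+ 2))].
Proof.
have [A [B [D lamE]]] := last_run_prob_closed p_gt0 q1_gt0 q2_gt0 pq1.
pose s n := p ^+ n * ((A * inv n ^+ 2 + B * inv n + D) / C0 q1 q2).
have os : Opow inv 4 s.
  apply: (@OpowM _ _ 4 0) => //.
  have h : Opow inv 0 (fun n => A / C0 q1 q2 * inv n ^+ 2 + B / C0 q1 q2 * inv n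
       + D / C0 q1 q2).
    apply: OpowD; last exact: Opow_cst.
    apply: OpowD; apply: OpowZ; last exact: Opow_weaken Opow_inv1.
    exact: (Opow_weaken inv01 _ (OpowX 2 Opow_inv1)).
  by apply: Opow_near h; apply: nearW => n; ring.
pose z n := k1 * inv n + k2 * inv n ^+ 2 + s n.
have oi2 := OpowX 2 Opow_inv1.
have or : Opow inv 2 (fun n => k2 * inv n ^+ 2 + s n).
  by apply: OpowD; [exact: OpowZ | exact: (Opow_weaken inv01 _ os)].
have oz : Opow inv 1 z.
  have h : Opow inv 1 (fun n => k1 * inv n + (k2 * inv n ^+ 2 + s n)).
    by apply: OpowD; [exact: OpowZ | exact: (Opow_weaken inv01 _ or)].
  by apply: Opow_near h; apply: nearW => n; rewrite /z addrA.
exists z; split => //.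
  apply: filterS (nbhs_infty_gtr (0 : R)) => n; rewrite ltr0n => n0.
  have n0' : n%:R != 0 :> R by rewrite pnatr_eq0 -lt0n.
  rewrite lamE // /z /s /amp /k1 /k2 /inv.
  move: (p ^+ n) (C2 _ _ _) (C1 _ _ _) => P c2 c1.
  have := C0_gt0; move: (C0 _ _) => c0 c00.
  by field; rewrite n0' !gt_eqF.
have oz3 : Opow inv 3 (fun n => ln (1 + z n) - (z n - z n ^+ 2 / 2)).
  have h1 := Opow_weaken inv01 (isT : 3 <= 4)%N (Opow_ln_remainder inv_small oz).
  have h2 := OpowZ (1 / 3) (OpowX 3 oz); rewrite mul1n in h2.
  by apply: Opow_near (OpowD h1 h2); apply: nearW => n; ring.
pose r n := k2 * inv n ^+ 2 + s n.
have o1 : Opow inv 3 (fun n => r n * (2 * k1 * inv n + r n)).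
  apply: (OpowM or); apply: OpowD; first exact: OpowZ.
  exact: (Opow_weaken inv01 _ or).
have o2 := OpowB (OpowD oz3 (Opow_weaken inv01 (isT : 3 <= 4)%N os)) (OpowZ (1 / 2) o1).
apply: Opow_near o2; apply: nearW => n.
(* The coefficient of 1/n^2 in ln(1 + k1/n + k2/n^2): this is the origin of [K]. *)
have -> : c * K p q1 q2 = k2 - k1 ^+ 2 / 2.
  rewrite /K /k1 /k2 -/c; move: (C2 _ _ _) (C1 _ _ _) => c2 c1.
  have := C0_gt0; move: (C0 _ _) => c0 c00.
  by field; rewrite !gt_eqF.
by rewrite /r /z; field.
Qed.

Variables (n : nat -> nat) (x : nat -> R).
Hypothesis Opow_x : Opow (scale p) 0 x.
Hypothesis nE : \forall N \near \oo, (n N)%:R = m p q1 q2 N + x N.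

Let rate N := p `^ (- (logp p amp + H p q1 q2 N (x N))).
Let L N : R := logp p (N%:R : R).

Let n_near (Q : set nat) : (\forall i \near \oo, Q i) -> \forall N \near \oo, Q (n N).
Proof.
move=> [M _ MQ].
apply: filterS2 (near_logp_ge p_gt0 p_lt1 (2 * M%:R))
  (nat_bounds p_gt0 p_lt1 q1_gt0 q2_gt0 Opow_x nE) => N LN /andP[nl _].
apply: MQ => /=; rewrite -(@ler_nat R); lra.
Qed.

Lemma rateE N : rate N = expR (ln amp + c * H p q1 q2 N (x N)).
Proof.
rewrite /rate /powR gt_eqF // /logp -/(C p) -/c; congr expR.
have -> : ln p = - c by rewrite /c /C lnV ?posrE // opprK.
by field; rewrite gt_eqF.
Qed.

Lemma rate_ratio : exists (k : R) (th : nat -> R),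
  \forall N \near \oo, N%:R * last_run_prob p q1 q2 (n N) = rate N * expR (th N)
    /\ `|th N| <= k * (L N)^-1 ^+ 3.
Proof.
have [z [oz lamE [kz hz]]] := last_run_prob_expansion.
have half : 0 < 1 / 2 :> R by lra.
have [ke he] := exponent_expansion p_gt0 p_lt1 q1_gt0 q2_gt0 Opow_x nE.
(* The logarithm of the ratio, so only its size remains to be estimated. *)
pose th N := ln (N%:R * last_run_prob p q1 q2 (n N)) - (ln amp + c * H p q1 q2 N (x N)).
(* The 8 comes from n >= L/2, which gives n^-3 <= 8 L^-3. *)
exists (c * ke + `|kz| * 8), th.
have hn := n_near (near_and (nbhs_infty_gtr (0 : R))
  (near_and lamE (near_and hz (Opow_small inv_small oz half)))).
have bn := nat_bounds p_gt0 p_lt1 q1_gt0 q2_gt0 Opow_x nE.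
have L1 := near_logp_ge p_gt0 p_lt1 1.
have N0 := nbhs_infty_gtr (0 : R).
have all := near_and (near_and L1 (near_and he (near_and N0 bn))) hn.
apply: filterS all => N.
move=> [[{}L1 [{}he [{}N0 /andP[nl nu]]]] [n0 [{}lamE [{}hz]]]].
rewrite ler_norml => /andP[z1 z2].
set nn : R := (n N)%:R in he nl nu n0 lamE hz *.
have z0 : 0 < 1 + z (n N) by lra.
have nn2 : 0 < nn ^+ 2 by rewrite exprn_gt0.
have lam0 : 0 < last_run_prob p q1 q2 (n N).
  rewrite lamE -/nn; apply: mulr_gt0 => //; apply: mulr_gt0 => //.
  by apply: mulr_gt0 => //; exact: exprn_gt0.
have lnlam : ln (last_run_prob p q1 q2 (n N)) =
    - (c * nn) + ln amp + 2 * ln nn + ln (1 + z (n N)).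
  have ln4 (a b d f : R) : 0 < a -> 0 < b -> 0 < d -> 0 < f ->
      ln (a * b * d * f) = ln a + ln b + ln d + ln f.
    by move=> *; rewrite !lnM ?posrE ?mulr_gt0.
  rewrite lamE exprn_expR -/nn ln4 ?expR_gt0 // expRK lnXn //.
  by rewrite -[ln nn *+ 2]mulr_natl.
split.
  rewrite rateE -expRD /th addrC subrK lnK // posrE mulr_gt0 //.
have -> : th N =
   c * (L N - nn + 2 / C p * ln nn
    + (C1 p q1 q2 - C0 q1 q2) / (C p * C0 q1 q2) * nn^-1
    + K p q1 q2 * nn^-1 ^+ 2 - H p q1 q2 N (x N))
   + (ln (1 + z (n N)) - (k1 * inv (n N) + c * K p q1 q2 * inv (n N) ^+ 2)).
  rewrite /th lnM ?posrE // lnlam /k1 /inv -/nn -/c.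
  have -> : ln N%:R = c * L N by rewrite /L /logp -/(C p) -/c mulrC divfK // gt_eqF.
  move: (ln _) (ln amp) (ln (1 + _)) (H _ _ _ _ _) (L N) (nn^-1) => a1 a2 a3 a4 a5 a6.
  by field; rewrite !gt_eqF.
have Li : 0 <= (L N)^-1 by rewrite invr_ge0 (le_trans ler01).
rewrite [leRHS]mulrDl; apply: (le_trans (ler_normD _ _)); apply: lerD.
  rewrite normrM (gtr0_norm c_gt0) -[leRHS]mulrA.
  exact: (ler_wpM2l (ltW c_gt0) he).
apply: (le_trans hz); apply: (@le_trans _ _ (`|kz| * inv (n N) ^+ 3)).
  by rewrite ler_wpM2r ?ler_norm // exprn_ge0 // invr_ge0.
rewrite -mulrA ler_wpM2l //.
have -> : 8 * (L N)^-1 ^+ 3 = (2 * (L N)^-1) ^+ 3 by rewrite exprMn; ring.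
have L0 : 0 < L N by rewrite (lt_le_trans ltr01).
rewrite lerXn2r ?nnegrE ?mulr_ge0 ?invr_ge0 ?(ltW L0) //.
have -> : 2 * (L N)^-1 = (L N / 2)^-1 by exact: (esym (invf_div (L N) 2)).
have h : 0 < L N / 2 by exact: (divr_gt0 L0).
by rewrite /inv -/nn lef_pV2 ?posrE.
Qed.

Lemma rate_bounded : exists k : R, \forall N \near \oo, rate N <= k.
Proof.
have [h hH] := Opow_H p_gt0 p_lt1 q1_gt0 q2_gt0 Opow_x.
exists (expR (ln amp + c * h)); apply: filterS hH => N; rewrite mulr1 => hH.
rewrite rateE ler_expR lerD2l ler_wpM2l ?(ltW c_gt0) //.
exact: le_trans (ler_norm _) hH.
Qed.

(** Clumping changes the run probability only by a bounded factor, so N P is bounded along with N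
    lam; this controls the error of [avoid_prob_approx]. *)
Lemma run_prob_le_last : exists2 k : R, 0 < k &
  \forall N \near \oo, run_prob p q1 q2 (n N) <= k * last_run_prob p q1 q2 (n N).
Proof.
have [z [oz lamE _]] := last_run_prob_expansion.
have half : 0 < 1 / 2 :> R by lra.
(* For n >= 1 the bracket of [run_prob_closed] is at most b n^2; the factor 2 below makes up for 1 +
   z >= 1/2. *)
pose b := 1 + (q1 + q2) / p + q1 * q2 / p ^+ 2.
have b0 : 0 < b by rewrite !addr_gt0 ?divr_gt0 ?mulr_gt0 ?addr_gt0 ?exprn_gt0.
exists (2 * b / amp); first by apply: divr_gt0 => //; exact: mulr_gt0.
apply: filterS (n_near (near_and (nbhs_infty_gtr (0 : R))
  (near_and lamE (Opow_small inv_small oz half)))).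
move=> N [n0 [-> ]]; rewrite ler_norml => /andP[z1 z2].
have pn1 : 1 - p != 0 by rewrite gt_eqF // subr_gt0.
rewrite run_prob_closed ?gt_eqF //.
have pw : 0 < p ^+ n N by rewrite exprn_gt0.
have n1 : 1 <= (n N)%:R :> R by move: n0; rewrite ltr0n ler1n.
move: ((n N)%:R) (p ^+ n N) pw n1 => i P P0 i1 {n0}.
have -> : 2 * b / amp * (P * amp * i ^+ 2 * (1 + z (n N))) =
   P * (b * i ^+ 2 * (2 * (1 + z (n N)))) by field; rewrite gt_eqF.
rewrite ler_wpM2l ?(ltW P0) //.
have u0 : 0 <= (q1 + q2) / p by rewrite divr_ge0 ?addr_ge0 ?ltW.
have v0 : 0 <= q1 * q2 / p ^+ 2 by rewrite divr_ge0 ?mulr_ge0 ?exprn_ge0 ?ltW.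
apply: (@le_trans _ _ (b * i ^+ 2)); last first.
  rewrite ler_peMr //; last by lra.
  by rewrite mulr_ge0 ?exprn_ge0 ?(ltW b0) //; lra.
rewrite -mulrA /b.
move: ((q1 + q2) / p) (q1 * q2 / p ^+ 2) u0 v0 => u v u0 v0.
have i2 : 1 <= i ^+ 2 by rewrite exprn_ege1.
have h1 : i * u <= i ^+ 2 * u by rewrite ler_wpM2r // expr2 ler_peMr //; lra.
have h2 : i * (i - 1) * v <= i ^+ 2 * v by rewrite ler_wpM2r // expr2 ler_wpM2l //; lra.
by lra.
Qed.

Lemma avoid_prob_asymptotic : exists k : R, \forall N \near \oo,
  `|avoid_prob p q1 q2 (n N) N / expR (- rate N) - 1| <= k * (L N)^-1 ^+ 3.
Proof.
have [kt [th hth]] := rate_ratio.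
have [kr hr] := rate_bounded.
have [kp kp0 hp] := run_prob_le_last.
have bn := nat_bounds p_gt0 p_lt1 q1_gt0 q2_gt0 Opow_x nE.
pose k3 := kp * (2 * kr).
exists (4 * kr * kt + expR kr * ((4 * k3 + 6 * k3 ^+ 2) * (24 / c ^+ 4))).
(* The thresholds bring |th| and |rate - N lam| below 1/2, the range of [expR_near1]. *)
have big := near_and (near_logp_ge p_gt0 p_lt1 1)
  (near_and (near_logp_ge p_gt0 p_lt1 (2 * kt)) (near_logp_ge p_gt0 p_lt1 (4 * kr * kt))).
apply: filterS3 (near_and hth (near_and hr hp)) (near_and big bn)
  (near_and (nbhs_infty_gtr (0 : R)) (n_near (nbhs_infty_gtr (0 : R)))).
move=> N [[lamE thb] [rb Pb]] [[L1 [L2 L3]] /andP[_ nu]] [N0 n0].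
have ln_N : ln N%:R = c * L N.
  by rewrite /L /logp -/(C p) -/c mulrC divfK // gt_eqF.
have expln : (c * L N) ^+ 4 / 24 <= N%:R.
  rewrite -ln_N -[leRHS]lnK ?posrE //; apply: expR_lower.
  by apply: ln_ge0; rewrite ler1n -(ltr0n R).
have n0' : (0 < n N)%N by rewrite -(ltr0n R).
have approx := avoid_prob_approx (ltW p_gt0) (ltW q1_gt0) (ltW q2_gt0) pq1 N n0'.
have P0 := run_prob_ge0 (ltW p_gt0) (ltW q1_gt0) (ltW q2_gt0) (n N).
have r0 : 0 < rate N by rewrite rateE expR_gt0.
rewrite -/(L N) in L1 L2 L3 nu *.
move: (avoid_prob _ _ _ _ _) (run_prob _ _ _ _) (last_run_prob _ _ _ _)
  (rate N) (th N) (L N) (n N)%:R lamE thb rb Pb L1 L2 L3 nu n0 expln approx P0 r0.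
move: N%:R N0 => M M0 {ln_N n0'} Q P lam r t l nn.
move=> lamE tb rb Pb l1 l2 l3 nu n0 expln approx P0 r0.
have l0 : 0 < l by lra.
have e0 : 0 < l^-1 by rewrite invr_gt0.
have e1 : l^-1 <= 1 by rewrite invf_le1.
have e3e : l^-1 ^+ 3 <= l^-1.
  by rewrite exprS ler_piMr ?(ltW e0) // exprn_ile1 // ltW.
have e30 : 0 < l^-1 ^+ 3 by rewrite exprn_gt0.
have kt0 : 0 <= kt by rewrite -(pmulr_lge0 _ e30) (le_trans _ tb).
have kr0 : 0 < kr by lra.
have ll : l^-1 * l = 1 by rewrite mulVf // gt_eqF.
have kte k : 0 <= k -> 2 * k <= l -> k * l^-1 ^+ 3 <= 1 / 2.
  move=> k0 kl; apply: (@le_trans _ _ (k * l^-1)); first by rewrite ler_wpM2l.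
  by rewrite ler_pdivrMr //; lra.
have t2 : `|t| <= 1 / 2 by apply: (le_trans tb); exact: kte.
have et := expR_near1 t2.
have et2 : expR t <= 2.
  have := ler_norm (expR t - 1); lra.
have Mlam : M * lam <= 2 * kr.
  rewrite lamE mulrC; apply: ler_pM => //; exact: ltW.
have dE : `|r - M * lam| <= 2 * kr * kt * l^-1 ^+ 3.
  have -> : r - M * lam = - (r * (expR t - 1)) by rewrite lamE; ring.
  rewrite normrN normrM (gtr0_norm r0) [2 * kr]mulrC -!mulrA.
  apply: ler_pM => //; first exact: ltW.
  by apply: (le_trans et); rewrite ler_wpM2l.
have d2 : `|r - M * lam| <= 1 / 2.
  apply: (le_trans dE); apply: kte; last by lra.
  by rewrite !mulr_ge0 // ltW.
have ed := expR_near1 d2.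
have k30 : 0 <= k3 by rewrite !mulr_ge0 // ltW.
have MP : M * P <= k3.
  apply: (@le_trans _ _ (kp * (M * lam))).
    by rewrite mulrCA ler_wpM2l // ltW.
  by rewrite ler_wpM2l // ltW.
have MP0 : 0 <= M * P by rewrite mulr_ge0 // ltW.
(* The declustering error is O(L/N), and N dominates L^4. *)
have lM : l / M <= 24 / c ^+ 4 * l^-1 ^+ 3.
  have -> : 24 / c ^+ 4 * l^-1 ^+ 3 = l * ((c * l) ^+ 4 / 24)^-1.
    by field; rewrite !gt_eqF.
  rewrite ler_wpM2l ?(ltW l0) // lef_pV2 ?posrE //.
  by rewrite divr_gt0 // exprn_gt0 // mulr_gt0.
have err : 2 * nn * P + 3 * nn * M * P ^+ 2 <=
    (4 * k3 + 6 * k3 ^+ 2) * (24 / c ^+ 4 * l^-1 ^+ 3).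
  apply: (@le_trans _ _ ((4 * k3 + 6 * k3 ^+ 2) * (l / M))); last first.
    by rewrite ler_wpM2l // addr_ge0 // mulr_ge0 // exprn_ge0.
  have -> : 2 * nn * P + 3 * nn * M * P ^+ 2 =
      nn * (2 * (M * P) + 3 * (M * P) ^+ 2) / M by field; rewrite gt_eqF.
  have -> : (4 * k3 + 6 * k3 ^+ 2) * (l / M) = 2 * l * (2 * k3 + 3 * k3 ^+ 2) / M.
    by ring.
  rewrite ler_wpM2r ?invr_ge0 ?(ltW M0) //; apply: ler_pM => //.
  - exact: ltW.
  - by rewrite addr_ge0 // mulr_ge0 // exprn_ge0.
  - by apply: lerD; rewrite ler_wpM2l // lerXn2r // nnegrE.
(* The first summand carries the declustering error, the second the error made in the rate. *)
have -> : Q / expR (- r) - 1 =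
    (Q - expR (- (lam * M))) * expR r + (expR (r - M * lam) - 1).
  rewrite expRN invrK mulrBl -expRD; have -> : - (lam * M) + r = r - M * lam by ring.
  by ring.
apply: (le_trans (ler_normD _ _)); rewrite [leRHS]mulrDl addrC; apply: lerD.
  by apply: (le_trans ed); lra.
rewrite normrM (ger0_norm (expR_ge0 _)) mulrC -[leRHS]mulrA; apply: ler_pM => //.
- by rewrite ler_expR.
- by apply: (le_trans approx); rewrite -[leRHS]mulrA.
Qed.

End Asymptotics.

(** * From random variables to words *)

Section Decode.
Variable R : realType.

Definition decode (x : letter) : R :=
  match x with None => 0 | Some true => 1 | Some false => -1 end.

Lemma decode_eq1 x : (decode x == 1) = (x == plus).
Proof.
case: x => [[]|] /=; rewrite ?eqxx // ?(eq_sym 0) ?oner_eq0 //.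
by rewrite lt_eqF //; lra.
Qed.

Lemma decode_eqN1 x : (decode x == -1) = (x == minus).
Proof.
case: x => [[]|] /=; rewrite ?eqxx //; last by rewrite eq_sym oppr_eq0 oner_eq0.
by rewrite gt_eqF //; lra.
Qed.

Lemma contaminated11_decode u s i :
  (forall j, (j < size s)%N -> u (i + j)%N = decode (nth None s j)) ->
  contaminated11 u i (size s) = admissible s.
Proof.
move=> us.
have e : [seq u j | j <- iota i (size s)] = map decode s.
  apply: (@eq_from_nth _ 0) => [|j]; rewrite !size_map size_iota // => js.
  by rewrite (nth_map 0%N) ?size_iota // nth_iota // (nth_map None) // us.
rewrite /contaminated11 e !count_map /admissible.
have -> : all (fun x : R => x \in [:: 0; 1; -1]) (map decode s).
  by apply/allP => y /mapP[x _ ->]; rewrite !inE; case: x => [[]|]; rewrite ?eqxx ?orbT.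
rewrite /=; congr (_ && _); congr (_ <= _)%N; apply: eq_count => x /=.
  exact: decode_eq1.
exact: decode_eqN1.
Qed.

Lemma contaminated11_sub (u : nat -> R) i n l : (n <= l)%N ->
  contaminated11 u i l -> contaminated11 u i n.
Proof.
move=> nl; rewrite /contaminated11 -(subnKC nl) iotaD map_cat all_cat !count_cat.
by move=> /and3P[/andP[-> _] c1 c2]; apply/andP; split => //; lia.
Qed.

(** A run of length at least [n] contains one of length exactly [n] with the same start, so only
    windows of length [n] need inspection. *)
Lemma longest_run_lt (u : nat -> R) N n : (0 < n)%N ->
  (longest_run u N < n)%N =
  all (fun i => ~~ ((i + n <= N)%N && contaminated11 u i n)) (iota 0 N.+1).
Proof.
move=> n0; apply/idP/allP => [lt i _|H].
  apply/negP => /andP[iN ci]; move: lt; rewrite ltnNge => /negP; apply.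
  have nN : (n < N.+1)%N by lia.
  have iN1 : (i < N.+1)%N by lia.
  apply: (@leq_bigmax_cond _ _ (fun l : 'I_N.+1 => l : nat) (Ordinal nN)).
  by apply/existsP; exists (Ordinal iN1); rewrite /= iN ci.
rewrite -(prednK n0) ltnS; apply/bigmax_leqP => l /existsP[i /andP[iN ci]].
rewrite -ltnS prednK // ltnNge; apply/negP => nl.
have := H i; rewrite mem_iota /= add0n ltn_ord => /(_ isT)/negP; apply.
rewrite (contaminated11_sub nl ci) andbT; lia.
Qed.

Lemma longest_run_decode u s N n : (0 < n)%N -> size s = N ->
  (forall i, (i < N)%N -> u i = decode (nth None s i)) ->
  (longest_run u N < n)%N = avoids n s.
Proof.
move=> n0 sN us; rewrite longest_run_lt //.
have E i : (i + n <= N)%N -> contaminated11 u i n = run_at n (drop i s).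
  move=> iN; have st : size (take n (drop i s)) = n by rewrite size_takel // size_drop; lia.
  rewrite /run_at size_drop sN; have -> : (n <= N - i)%N by lia.
  rewrite /= -[n in LHS]st contaminated11_decode // => j; rewrite st => jn.
  by rewrite nth_take // nth_drop us //; lia.
apply/allP/avoidsP => [H i|H i _]; last first.
  apply/negP => /andP[iN]; rewrite E //; apply/negP/H; lia.
rewrite sN => iN; apply/negP => r.
have iN' : (i + n <= N)%N by move: r => /andP[]; rewrite size_drop; lia.
have := H i; rewrite mem_iota /= add0n => /(_ _)/negP; apply; first lia.
by rewrite iN' E.
Qed.

End Decode.

(** * Law of the first N variables *)

Section Law.
Context d (T : measurableType d) (R : realType).
Variables (P : probability T R) (X : nat -> {RV P >-> R}).

Lemma measurable_eq i (r : R) : measurable [set w | X i w = r].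
Proof.
rewrite (_ : [set w | _] = X i @^-1` [set r]) //.
Qed.

Lemma measurable_eqb i (r : R) : measurable [set w | X i w == r].
Proof.
rewrite (_ : [set w | _] = [set w | X i w = r]); first exact: measurable_eq.
by apply/seteqP; split => w /= /eqP.
Qed.

Lemma measurable_constb (b : bool) : measurable [set w : T | b].
Proof.
case: b.
  rewrite (_ : [set w | _] = setT); first exact: measurableT.
  by apply/seteqP; split.
rewrite (_ : [set w | _] = set0); first exact: measurable0.
by apply/seteqP; split.
Qed.

Lemma measurable_negb (f : T -> bool) :
  measurable [set w | f w] -> measurable [set w | ~~ f w].
Proof.
move=> mf; rewrite (_ : [set w | _] = ~` [set w | f w]); first exact: measurableC.
by apply/seteqP; split => w /= /negP.
Qed.

Lemma measurable_andb (f g : T -> bool) :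
  measurable [set w | f w] -> measurable [set w | g w] ->
  measurable [set w | f w && g w].
Proof.
move=> mf mg; rewrite (_ : [set w | _] = [set w | f w] `&` [set w | g w]).
  exact: measurableI.
by apply/seteqP; split => w /=; [move/andP | move=> h; apply/andP].
Qed.

Lemma measurable_orb (f g : T -> bool) :
  measurable [set w | f w] -> measurable [set w | g w] ->
  measurable [set w | f w || g w].
Proof.
move=> mf mg; rewrite (_ : [set w | _] = [set w | f w] `|` [set w | g w]).
  exact: measurableU.
by apply/seteqP; split => w /=; [move/orP | move=> h; apply/orP].
Qed.

Lemma measurable_all (I : Type) (f : I -> T -> bool) s :
  (forall i, measurable [set w | f i w]) ->
  measurable [set w | all (f^~ w) s].
Proof.
move=> mf; elim: s => [|i s IH] /=; last exact: measurable_andb.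
by rewrite (_ : [set w | _] = setT) //; apply/seteqP.
Qed.

Lemma measurable_count r s k :
  measurable [set w | (count_mem r [seq X j w | j <- s] <= k)%N].
Proof.
elim: s k => [|j s IH] k /=.
  exact: (measurable_constb true).
rewrite (_ : [set w | _] = [set w |
    ((X j w == r) && ((0 < k)%N && (count_mem r [seq X j w | j <- s] <= k.-1)%N)) ||
    (~~ (X j w == r) && (count_mem r [seq X j w | j <- s] <= k)%N)]).
  apply: measurable_orb; apply: measurable_andb => //.
  - exact: measurable_eqb.
  - by apply: measurable_andb => //; exact: measurable_constb.
  - by apply: measurable_negb; exact: measurable_eqb.
apply/seteqP; split => w /=; case: (X j w == r); rewrite /= ?add1n ?add0n ?orbF //.
  by case: k {IH}.
by case: k {IH}.
Qed.

Lemma measurable_contaminated11 i l :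
  measurable [set w | contaminated11 (fun j => X j w) i l].
Proof.
rewrite /contaminated11; apply: measurable_andb; last first.
  by apply: measurable_andb; exact: measurable_count.
rewrite (_ : [set w | _] = [set w | all (fun j => X j w \in [:: 0; 1; -1]) (iota i l)]).
  apply: (measurable_all (f := fun j w => X j w \in [:: 0; 1; -1])) => j.
  rewrite (_ : [set w | _] = [set w | (X j w == 0) || ((X j w == 1) || (X j w == -1))]).
    by do ?apply: measurable_orb; exact: measurable_eqb.
  by apply/seteqP; split => w /=; rewrite !inE.
by apply/seteqP; split => w /=; rewrite all_map.
Qed.

Lemma measurable_longest_run_lt N n : (0 < n)%N ->
  measurable [set w | (longest_run (fun i => X i w) N < n)%N].
Proof.
move=> n0.
rewrite (_ : [set w | _] = [set w | all (fun i =>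
   ~~ ((i + n <= N)%N && contaminated11 (fun i => X i w) i n)) (iota 0 N.+1)]).
  apply: (measurable_all (f := fun i w =>
    ~~ ((i + n <= N)%N && contaminated11 (fun i => X i w) i n))) => i.
  apply: measurable_negb; apply: measurable_andb; last exact: measurable_contaminated11.
  exact: measurable_constb.
by apply/seteqP; split => w /=; rewrite longest_run_lt.
Qed.

Variables (p q1 q2 : R).
Hypothesis pq1 : p + q1 + q2 = 1.
Hypothesis X_indep : mutually_independent X.
Hypothesis X_0 : forall i, P [set w | X i w = 0] = p%:E.
Hypothesis X_p1 : forall i, P [set w | X i w = 1] = q1%:E.
Hypothesis X_m1 : forall i, P [set w | X i w = -1] = q2%:E.

Definition letter_prob (x : letter) : R :=
  match x with None => p | Some true => q1 | Some false => q2 end.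

Let X_letter i x : P [set w | X i w = decode R x] = (letter_prob x)%:E.
Proof. by case: x => [[]|]; rewrite /= ?X_0 ?X_p1 ?X_m1. Qed.

Let split3 i (A : set T) : measurable A ->
  P A = (P (A `&` [set w | X i w = 0%R]) + P (A `&` [set w | X i w = 1%R])
    + P (A `&` [set w | X i w = (-1)%R])
    + P (A `\` [set w | X i w = 0%R] `\` [set w | X i w = 1%R]
         `\` [set w | X i w = (-1)%R]))%E.
Proof.
move=> mA.
have m0 := measurable_eq i 0; have m1 := measurable_eq i 1.
have m2 := measurable_eq i (-1).
have ne1 (w : T) : X i w = 1 -> X i w <> 0 by move=> ->; apply/eqP; rewrite oner_eq0.
have ne2 (w : T) : X i w = -1 -> X i w <> 0.
  by move=> ->; apply/eqP; rewrite oppr_eq0 oner_eq0.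
have ne3 (w : T) : X i w = -1 -> X i w <> 1.
  by move=> ->; apply/eqP; rewrite lt_eqF //; lra.
have mA0 := measurableD mA m0; have mA1 := measurableD mA0 m1.
have dI (B D : set T) : measurable B -> measurable D ->
  (P B = P (B `\` D) + P (B `&` D))%E by move=> mB mD; exact: measureDI.
rewrite (dI _ _ mA m0) (dI _ _ mA0 m1) (dI _ _ mA1 m2).
have -> : (A `\` [set w | X i w = 0]) `&` [set w | X i w = 1] =
    A `&` [set w | X i w = 1].
  apply/seteqP; split => w /=; first by move=> [[]].
  by move=> [a h]; have h0 := ne1 _ h.
have -> : (A `\` [set w | X i w = 0] `\` [set w | X i w = 1]) `&` [set w | X i w = -1] =
    A `&` [set w | X i w = -1].
  apply/seteqP; split => w /=; first by move=> [[[]]].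
  by move=> [a h]; have h0 := ne2 _ h; have h1 := ne3 _ h.
move: (P _) (P _) (P _) (P _) => a b e f.
by rewrite addeC [X in (_ + X = _)%E]addeC [X in (_ + (_ + X) = _)%E]addeC !addeA.
Qed.


Let measurable_other i (A : set T) : measurable A ->
  measurable (A `\` [set w | X i w = 0%R] `\` [set w | X i w = 1%R]
         `\` [set w | X i w = (-1)%R]).
Proof.
by move=> mA; apply: measurableD; [apply: measurableD; [apply: measurableD|]|] => //;
  exact: measurable_eq.
Qed.

(** The three values already carry total mass p + q1 + q2 = 1; any other value of [X i] has
    probability zero. *)
Let P_other i : P (setT `\` [set w | X i w = 0%R] `\` [set w | X i w = 1%R]
         `\` [set w | X i w = (-1)%R]) = 0%E.
Proof.
have := split3 i (@measurableT _ T).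
rewrite !setTI X_0 X_p1 X_m1 probability_setT -!EFinD pq1.
set r := P _; have : (r \is a fin_num)%E by apply: fin_num_measure; exact: measurable_other.
by case: r => // r _ [] h; congr (_%:E); lra.
Qed.

Lemma prob_split i (A : set T) : measurable A ->
  P A = (P (A `&` [set w | X i w = 0%R]) + P (A `&` [set w | X i w = 1%R])
    + P (A `&` [set w | X i w = (-1)%R]))%E.
Proof.
move=> mA; rewrite (split3 i mA).
have -> : P (A `\` [set w | X i w = 0%R] `\` [set w | X i w = 1%R]
         `\` [set w | X i w = (-1)%R]) = 0%E.
  apply/eqP; rewrite -measure_le0 -(P_other i); apply: le_measure.
  - by rewrite inE; exact: measurable_other.
  - by rewrite inE; exact: measurable_other.
  - by move=> w /= [[[_ h0] h1] h2].
by rewrite adde0.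
Qed.

Definition cylinder (v : seq letter) : set T :=
  [set w | forall i, (i < size v)%N -> X i w = decode R (nth None v i)].

Lemma cylinder_rcons v x :
  cylinder (rcons v x) = cylinder v `&` [set w | X (size v) w = decode R x].
Proof.
apply/seteqP; split => w /=.
  move=> h; split => [i iv|].
    by have := h i; rewrite nth_rcons iv size_rcons ltnS (ltnW iv); exact.
  by have := h (size v); rewrite nth_rcons ltnn eqxx size_rcons ltnSn; exact.
move=> [h1 h2] i; rewrite size_rcons ltnS nth_rcons leq_eqVlt => /orP[/eqP ->|iv].
  by rewrite ltnn eqxx.
by rewrite iv; exact: h1.
Qed.

Lemma measurable_cylinder v : measurable (cylinder v).
Proof.
elim/last_ind: v => [|v x IH].
  by rewrite (_ : cylinder _ = setT) //; apply/seteqP.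
by rewrite cylinder_rcons; apply: measurableI => //; exact: measurable_eq.
Qed.

Lemma prob_cylinder v : P (cylinder v) = (\prod_(x <- v) letter_prob x)%:E.
Proof.
pose J := [fset j | j in index_iota 0 (size v)]%fset.
pose B j : set R := [set decode R (nth None v j)].
have mB j : j \in J -> measurable (B j) by move=> _; exact: measurable_set1.
have := X_indep mB.
have -> : \bigcap_(j in [set` J]) (X j @^-1` B j) = cylinder v.
  apply/seteqP; split => w h i.
    by move=> iv; apply: h => /=; rewrite in_fset /= mem_index_iota.
  by rewrite /= in_fset /= mem_index_iota => iv; exact: h.
move=> ->.
have -> : (\prod_(j <- J) P (X j @^-1` B j))%E =
   (\prod_(j <- index_iota 0 (size v)) P (X j @^-1` B j))%E.
  apply: perm_big; apply: uniq_perm; rewrite ?fset_uniq ?iota_uniq // => j.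
  by rewrite in_fset.
rewrite -prodEFin (big_nth None) !big_mkord.
by apply: eq_bigr => i _; exact: X_letter.
Qed.

(** [D] and [g] have to agree only where the first [N] variables take letter values; the other
    outcomes form a null set. *)
Lemma prob_expect N (D : set T) (g : seq letter -> bool) : measurable D ->
  (forall s, size s = N -> forall w, cylinder s w -> D w <-> g s) ->
  P D = (expect p q1 q2 N (fun s => (g s)%:R))%:E.
Proof.
move=> mD Dg.
(* [v] is the word revealed so far. Each step reveals one more letter by [prob_split]; independence
   enters through [prob_cylinder] when all [N] are known. *)
suff main k v : (size v + k = N)%N -> P (cylinder v `&` D) =
    ((\prod_(x <- v) letter_prob x) * expect p q1 q2 k (fun s => (g (v ++ s))%:R))%:E.
  rewrite -[D]setTI; have := main N [::] erefl; rewrite big_nil mul1r => <-.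
  by congr (P (_ `&` _)); apply/seteqP.
elim: k v => [|k IH] v sv.
  rewrite addn0 in sv; rewrite /= cats0; case: (boolP (g v)) => gv.
    rewrite (_ : _ `&` _ = cylinder v) ?prob_cylinder ?mulr1 //.
    by apply/seteqP; split => w /=; [move=> []|move=> h; split => //; apply/(Dg v)].
  rewrite (_ : _ `&` _ = set0) ?measure0 ?mulr0 //.
  by apply/seteqP; split => w //= [h /(Dg v sv w h)]; rewrite (negPf gv).
have step x : P (cylinder v `&` D `&` [set w | X (size v) w = decode R x]) =
   ((\prod_(x <- v) letter_prob x) * (letter_prob x *
     expect p q1 q2 k (fun s => (g (v ++ x :: s))%:R)))%:E.
  rewrite setIAC -cylinder_rcons IH; last by rewrite size_rcons addSnnS.
  rewrite -cats1 big_cat big_seq1 /= mulrA; congr ((_ * _)%:E).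
  by apply: eq_expect => s _; rewrite -catA.
rewrite (@prob_split (size v)); last by apply: measurableI => //; exact: measurable_cylinder.
rewrite [X in (X + _ + _)%E](step None) [X in (_ + X + _)%E](step plus).
rewrite [X in (_ + _ + X)%E](step minus) -!EFinD /= -!mulrDr.
by [].
Qed.

Lemma prob_longest_run_lt N n : (0 < n)%N ->
  P [set w | (longest_run (fun i => X i w) N < n)%N] =
  (avoid_prob p q1 q2 n N)%:E.
Proof.
move=> n0; apply: prob_expect; first exact: measurable_longest_run_lt.
move=> s sN w cw; rewrite /= (@longest_run_decode _ _ s) // => i iN.
by apply: cw; rewrite sN.
Qed.

End Law.

Theorem theorem2p2 (d : measure_display) (T : measurableType d) (R : realType)
    (P : probability T R) (X : nat -> {RV P >-> R}) (p q1 q2 : R)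
    (p_gt0 : 0 < p) (q1_gt0 : 0 < q1) (q2_gt0 : 0 < q2)
    (pq1 : p + q1 + q2 = 1)
    (X_indep : mutually_independent X)
    (X_0 : forall i, P [set w | X i w = 0] = p%:E)
    (X_p1 : forall i, P [set w | X i w = 1] = q1%:E)
    (X_m1 : forall i, P [set w | X i w = -1] = q2%:E)
    (k : int) :
  exists eps : nat -> R,
    eps =O_\oo (fun N : nat => 1 / (logp p N%:R) ^+ 3) /\
    \forall N \near \oo,
      P [set w | (longest_run (fun i => X i w) N)%:Z
                 - Num.floor (m p q1 q2 N) < k] =
      (expR (- p `^ (- (logp p (C0 q1 q2 * p ^- 2 * q1 * q2)
                        + H p q1 q2 N (k%:~R - frac (m p q1 q2 N)))))
       * (1 + eps N))%:E.
Proof.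
have p_lt1 : p < 1 by rewrite -[ltRHS]pq1 -addrA ltrDl addr_gt0.
(* [absz] only converts to a natural number: [m(N)] + k is eventually positive. *)
pose n N := absz (Num.floor (m p q1 q2 N) + k).
pose x N : R := k%:~R - frac (m p q1 q2 N).
have ox : Opow (scale p) 0 x.
  exists (`|k%:~R| + 1); apply: nearW => N; rewrite mulr1.
  apply: (le_trans (ler_normB _ _)); rewrite lerD2l /frac.
  have /andP[] := floor_itv (m p q1 q2 N).
  rewrite intrD => h1 h2; rewrite ger0_norm; lra.
have pos : \forall N \near \oo, 0 < Num.floor (m p q1 q2 N) + k.
  apply: filterS (near_m_ge p_gt0 p_lt1 q1_gt0 q2_gt0 (1 - k)%:~R) => N h.
  have : 1 - k <= Num.floor (m p q1 q2 N) by rewrite real_floor_ge_int ?num_real.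
  lia.
have nE : \forall N \near \oo, (n N)%:R = m p q1 q2 N + x N.
  apply: filterS pos => N hpos.
  rewrite /n natr_absz ger0_norm ?(ltW hpos) // intrD /x /frac; ring.
have [ka hka] := avoid_prob_asymptotic p_gt0 q1_gt0 q2_gt0 pq1 ox nE.
pose rate N := p `^ (- (logp p (C0 q1 q2 * p ^- 2 * q1 * q2) + H p q1 q2 N (x N))).
(* The witness is the relative error itself, so the identity is exact once n is positive. *)
exists (fun N => avoid_prob p q1 q2 (n N) N / expR (- rate N) - 1); split.
  apply/eqO_exP; exists (`|ka| + 1); first by rewrite ltr_wpDl.
  apply: filterS2 hka (near_logp_ge p_gt0 p_lt1 1) => N h L1.
  have L0 : 0 <= logp p (N%:R : R) by rewrite (le_trans ler01).
  apply: (le_trans h); rewrite div1r -exprVn (@ger0_norm _ (_ ^+ 3)) ?exprn_ge0 ?invr_ge0 //.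
  rewrite ler_wpM2r ?exprn_ge0 ?invr_ge0 //.
  by rewrite (le_trans (ler_norm ka)) // lerDl.
apply: filterS pos => N hpos; rewrite -/(x N) -/(rate N).
have n0 : (0 < n N)%N by rewrite absz_gt0 gt_eqF.
rewrite addrC subrK mulrC divfK ?gt_eqF ?expR_gt0 //.
rewrite -(prob_longest_run_lt pq1 X_indep X_0 X_p1 X_m1 N n0); congr (P _).
by apply/seteqP; split => w /=; rewrite /n; lia.
Qed.
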